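(* Let $M$ be a compact, connected, oriented 3-manifold with marked point $p_0\in M$, and let $\rho:(S^3)^M\to (S^2)^M_*$, $\rho(\psi)=\pi\circ\psi$, be the map induced by the Hopf map $\pi:S^3\to S^2$. If $\pi_1(M)$ is finite, then for every choice of basepoint $\psi_0\in (S^3)^M$ the induced homomorphism $$\rho_*:\pi_1((S^3)^M,\psi_0)\to\pi_1((S^2)^M_*,\rho(\psi_0))$$ is an isomorphism.
   Context: Manifolds are without boundary. $(S^3)^M$ denotes the space of continuous maps $M\to S^3$ sending $p_0$ to $(1,0)$, where $S^3$ is the unit sphere in $\mathbb{C}^2$. $(S^2)^M$ denotes the space of continuous maps $M\to S^2$ sending $p_0$ to $(0,0,1)$. Both carry the compact-open topology. Let $\mu$ be a generating 2-cocycle for $H^2(S^2;\mathbb{Z})=\mathbb{Z}$. The subspace $(S^2)^M_*\subset (S^2)^M$ of algebraically inessential maps consists of those $\phi\in(S^2)^M$ with $[\phi^*\mu]=0$ in $H^2(M;\mathbb{Z})$. The Hopf map $\pi:S^3\to S^2$ is $\pi(z_1,z_2)=[z_1,z_2]$, where $S^2$ is identified with $\mathbb{C}P^1$ so that $[1,0]$ corresponds to $(0,0,1)$. Composition with $\pi$ sends $(S^3)^M$ into $(S^2)^M_*$. *)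

(* Defs.v *)
From HB Require Import structures.
From mathcomp Require Import all_boot all_order all_algebra.
From mathcomp Require Import generic_quotient.
From mathcomp Require Import all_classical all_reals all_analysis.
From mathcomp Require Import homotopy complex freeg.
From mathcomp Require Import ring lra.

Set Implicit Arguments.
Unset Strict Implicit.
Unset Printing Implicit Defensive.

Import Order.TTheory GRing.Theory Num.Theory.
Import numFieldNormedType.Exports numFieldTopology.Exports.
Local Open Scope classical_set_scope.
Local Open Scope complex_scope.
Local Open Scope quotient_scope.
Local Open Scope ring_scope.

Definition unit_itv (R : realType) : Type := set_type `[0 : R, 1]%classic.

HB.instance Definition _ (R : realType) := Topological.on (unit_itv R).

Section UnitInterval.
Context {R : realType}.
Local Notation I := (unit_itv R).

Definition itv_val (t : I) : R := \val t.

Fact clamp_subproof (t : R) : Num.max 0 (Num.min 1 t) \in `[0 : R, 1]%classic.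
Proof. by rewrite inE /= in_itv /= le_max lexx ge_max ler01 ge_min lexx. Qed.

Definition clamp (t : R) : I :=
  exist (fun u => u \in `[0 : R, 1]%classic) _ (clamp_subproof t).

Lemma itv_val_ge0 (t : I) : 0 <= itv_val t.
Proof. by have := set_valP t; rewrite /= in_itv /= => /andP[]. Qed.

Lemma itv_val_le1 (t : I) : itv_val t <= 1.
Proof. by have := set_valP t; rewrite /= in_itv /= => /andP[]. Qed.

Lemma itv_valK : cancel itv_val clamp.
Proof.
move=> t; apply/val_inj => /=; rewrite -/(itv_val t).
by rewrite (min_idPr (itv_val_le1 t)) (max_idPr (itv_val_ge0 t)).
Qed.

Lemma clampK (t : R) : 0 <= t -> t <= 1 -> itv_val (clamp t) = t.
Proof. by move=> t0 t1; rewrite /itv_val /= (min_idPr t1) (max_idPr t0). Qed.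

Fact itv_zero_neq_one : clamp 0 != clamp 1.
Proof.
apply/eqP => /(congr1 itv_val); rewrite !clampK ?lexx ?ler01 // => /esym/eqP.
by rewrite oner_eq0.
Qed.

HB.instance Definition _ :=
  @isBiPointed.Build I (clamp 0) (clamp 1) itv_zero_neq_one.

Lemma itv_val0 : itv_val zero = 0. Proof. by rewrite clampK ?lexx ?ler01. Qed.

Lemma itv_val1 : itv_val one = 1. Proof. by rewrite clampK ?lexx ?ler01. Qed.

Lemma clamp_le0 (t : R) : t <= 0 -> clamp t = zero.
Proof.
move=> t0; apply/val_inj => /=.
by rewrite (min_idPr (le_trans t0 ler01)) (max_idPl t0) (min_idPr ler01) maxxx.
Qed.

Lemma clamp_ge1 (t : R) : 1 <= t -> clamp t = one.
Proof. by move=> t1; apply/val_inj => /=; rewrite (min_idPl t1) minxx. Qed.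

Lemma itv_val_continuous : continuous itv_val.
Proof. exact: initial_continuous. Qed.

Lemma cts_cst (T Y : topologicalType) (y : Y) : continuous (fun _ : T => y).
Proof. by move=> t; exact: cvg_cst. Qed.

Lemma cts_id (T : topologicalType) : continuous (fun t : T => t).
Proof. by move=> t; exact: cvg_id. Qed.

Lemma cts_comp (T U Y : topologicalType) (g : U -> Y) (f : T -> U) :
  continuous g -> continuous f -> continuous (fun t => g (f t)).
Proof. by move=> cg cf t; exact: continuous_comp (cf t) (cg (f t)). Qed.

Lemma cts_pair (T U V : topologicalType) (f : T -> U) (g : T -> V) :
  continuous f -> continuous g -> continuous (fun t => (f t, g t)).
Proof. by move=> cf cg t; apply: cvg_pair; [exact: cf|exact: cg]. Qed.

Lemma cts_fst (T U : topologicalType) : continuous (@fst T U).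
Proof. by move=> t; exact: cvg_fst. Qed.

Lemma cts_snd (T U : topologicalType) : continuous (@snd T U).
Proof. by move=> t; exact: cvg_snd. Qed.

Section RealValued.
Context {T : topologicalType} (f g : T -> R).
Context (cf : continuous f) (cg : continuous g).

Lemma cts_max : continuous (fun t => Num.max (f t) (g t)).
Proof. by move=> t; apply: continuous_max; [exact: cf|exact: cg]. Qed.

Lemma cts_min : continuous (fun t => Num.min (f t) (g t)).
Proof. by move=> t; apply: continuous_min; [exact: cf|exact: cg]. Qed.

Lemma cts_add : continuous (fun t => f t + g t).
Proof. by move=> t; apply: cvgD; [exact: cf|exact: cg]. Qed.

Lemma cts_sub : continuous (fun t => f t - g t).
Proof. by move=> t; apply: cvgB; [exact: cf|exact: cg]. Qed.

Lemma cts_mul : continuous (fun t => f t * g t).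
Proof. by move=> t; apply: cvgM; [exact: cf|exact: cg]. Qed.

End RealValued.

Lemma clamp_continuous : continuous clamp.
Proof.
apply: continuous_comp_initial; apply: cts_max; first exact: cts_cst.
by apply: cts_min; [exact: cts_cst|exact: cts_id].
Qed.

Lemma cts_clamp (T : topologicalType) (f : T -> R) :
  continuous f -> continuous (fun t => clamp (f t)).
Proof. by move=> cf; apply: cts_comp => //; exact: clamp_continuous. Qed.

Lemma cts_val (T : topologicalType) (f : T -> I) :
  continuous f -> continuous (fun t => itv_val (f t)).
Proof. by move=> cf; apply: cts_comp => //; exact: itv_val_continuous. Qed.

Lemma continuous_if_le0 (T Y : topologicalType) (h : T -> R) (f g : T -> Y) :
  continuous h -> continuous f -> continuous g ->
  (forall t, h t = 0 -> f t = g t) ->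
  continuous (fun t => if h t <= 0 then f t else g t).
Proof.
move=> ch cf cg fg t A /=.
case: (ltgtP (h t) 0) => [ht|ht|ht] At; near_simpl; near=> u => /=.
- rewrite ifT; first by near: u; exact: (cf t).
  by apply: ltW; near: u; exact: (ch t _ (lt_nbhsl ht)).
- rewrite ifF; first by near: u; exact: (cg t).
  apply/negbTE; rewrite -ltNge.
  by near: u; exact: (ch t _ (lt_nbhsr ht)).
- case: ifP => _; first by near: u; exact: (cf t).
  by near: u; apply: (cg t); rewrite /= -(fg _ ht).
Unshelve. all: by end_near. Qed.

End UnitInterval.

Section Paths.
Context {R : realType} {X : topologicalType}.
Local Notation I := (unit_itv R).

Definition path_homotopic {x y : X} (p q : {path I from x to y}) : Prop :=
  exists H : I * I -> X,
    [/\ continuous H,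
        forall t, H (t, zero) = p t,
        forall t, H (t, one) = q t
      & forall s, H (zero, s) = x /\ H (one, s) = y].

Definition path_line {x y : X} (p : {path I from x to y}) : R -> X :=
  p \o clamp.

Lemma path_line_continuous {x y : X} (p : {path I from x to y}) :
  continuous (path_line p).
Proof.
by apply: cts_comp; [exact: cts_fun|exact: clamp_continuous].
Qed.

Lemma path_line_le0 {x y : X} (p : {path I from x to y}) t :
  t <= 0 -> path_line p t = x.
Proof. by move=> t0; rewrite /path_line /= clamp_le0 // path_zero. Qed.

Lemma path_line_ge1 {x y : X} (p : {path I from x to y}) t :
  1 <= t -> path_line p t = y.
Proof. by move=> t0; rewrite /path_line /= clamp_ge1 // path_one. Qed.

Lemma path_lineE {x y : X} (p : {path I from x to y}) t :
  p t = path_line p (itv_val t).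
Proof. by rewrite /path_line /= itv_valK. Qed.

Definition concat_line {x y z : X} (p : {path I from x to y})
    (q : {path I from y to z}) (t : R) : X :=
  if t - 1 <= 0 then path_line p t else path_line q (t - 1).

Lemma concat_line_continuous {x y z : X} (p : {path I from x to y})
  (q : {path I from y to z}) : continuous (concat_line p q).
Proof.
apply: continuous_if_le0.
- by apply: cts_sub; [exact: cts_id|exact: cts_cst].
- exact: path_line_continuous.
- apply: cts_comp; first exact: path_line_continuous.
  by apply: cts_sub; [exact: cts_id|exact: cts_cst].
by move=> t t1; rewrite path_line_ge1 ?path_line_le0 ?t1 //; lra.
Qed.

Section Concat.
Context {x y z : X} (p : {path I from x to y}) (q : {path I from y to z}).

Definition concat_fun (t : I) : X := concat_line p q (2 * itv_val t).

Fact concat_continuous : continuous concat_fun.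
Proof.
apply: cts_comp; first exact: concat_line_continuous.
by apply: cts_mul; [exact: cts_cst|exact: itv_val_continuous].
Qed.

Fact concat_zero : concat_fun zero = x.
Proof.
by rewrite /concat_fun itv_val0 mulr0 /concat_line sub0r lerN10 path_line_le0.
Qed.

Fact concat_one : concat_fun one = z.
Proof.
rewrite /concat_fun itv_val1 /concat_line ifF; last by apply/negbTE; lra.
by rewrite path_line_ge1 //; lra.
Qed.

Definition concat : {path I from x to z} :=
  mk_path concat_continuous concat_zero concat_one.

Lemma concatE t : concat t = concat_line p q (2 * itv_val t).
Proof. by []. Qed.

End Concat.

Section Reverse.
Context {x y : X} (p : {path I from x to y}).

Definition reverse_fun (t : I) : X := path_line p (1 - itv_val t).

Fact reverse_continuous : continuous reverse_fun.
Proof.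
apply: cts_comp; first exact: path_line_continuous.
by apply: cts_sub; [exact: cts_cst|exact: itv_val_continuous].
Qed.

Fact reverse_zero : reverse_fun zero = y.
Proof. by rewrite /reverse_fun itv_val0 subr0 path_line_ge1. Qed.

Fact reverse_one : reverse_fun one = x.
Proof. by rewrite /reverse_fun itv_val1 subrr path_line_le0. Qed.

Definition reverse : {path I from y to x} :=
  mk_path reverse_continuous reverse_zero reverse_one.

Lemma reverseE t : reverse t = path_line p (1 - itv_val t).
Proof. by []. Qed.

Lemma reverse_lineE (t : R) : path_line reverse t = path_line p (1 - t).
Proof.
rewrite {1}/path_line /= reverseE.
have [t0|t0] := leP t 0.
  by rewrite clamp_le0 // itv_val0 !path_line_ge1 //; lra.
have [t1|t1] := leP 1 t.
  by rewrite clamp_ge1 // itv_val1 !path_line_le0 //; lra.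
by rewrite clampK // ltW.
Qed.

End Reverse.

Definition cst_path (x : X) : {path I from x to x} := cst x.

Lemma path_homotopic_refl {x y : X} (p : {path I from x to y}) :
  path_homotopic p p.
Proof.
exists (p \o fst); split=> //; last by move=> s /=; rewrite path_zero path_one.
by apply: cts_comp; [exact: cts_fun|exact: cts_fst].
Qed.

Lemma path_homotopic_sym {x y : X} (p q : {path I from x to y}) :
  path_homotopic p q -> path_homotopic q p.
Proof.
move=> [H [cH H0 H1 Hs]].
exists (fun u => H (u.1, clamp (1 - itv_val u.2))); split=> /=.
- apply: cts_comp => //; apply: cts_pair; first exact: cts_fst.
  apply/cts_clamp/cts_sub; first exact: cts_cst.
  exact/cts_val/cts_snd.
- by move=> t; rewrite itv_val0 subr0.
- by move=> t; rewrite itv_val1 subrr.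
- by move=> s; exact: Hs.
Qed.

Lemma path_homotopic_trans {x y : X} (p q r : {path I from x to y}) :
  path_homotopic p q -> path_homotopic q r -> path_homotopic p r.
Proof.
move=> [H [cH H0 H1 Hs]] [K [cK K0 K1 Ks]].
have cs : continuous (fun u : I * I => 2 * itv_val u.2).
  by apply: cts_mul; [exact: cts_cst|exact/cts_val/cts_snd].
have cs1 : continuous (fun u : I * I => 2 * itv_val u.2 - 1).
  by apply: cts_sub; [exact: cs|exact: cts_cst].
exists (fun u => if 2 * itv_val u.2 - 1 <= 0
                 then H (u.1, clamp (2 * itv_val u.2))
                 else K (u.1, clamp (2 * itv_val u.2 - 1))); split=> /=.
- apply: continuous_if_le0 => //.
  + apply: cts_comp => //; apply: cts_pair; first exact: cts_fst.
    exact: cts_clamp.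
  + apply: cts_comp => //; apply: cts_pair; first exact: cts_fst.
    exact: cts_clamp.
  + move=> [t s] /= ts; rewrite clamp_ge1 ?clamp_le0 ?H1 ?K0 //; lra.
- by move=> t; rewrite itv_val0 mulr0 sub0r lerN10 H0.
- move=> t; rewrite itv_val1 ifF; last by apply/negbTE; lra.
  by rewrite clamp_ge1 ?K1 //; lra.
- by move=> s; case: ifP => _; [exact: Hs|exact: Ks].
Qed.

Lemma path_homotopic_concat {x y z : X} (p p' : {path I from x to y})
    (q q' : {path I from y to z}) :
  path_homotopic p p' -> path_homotopic q q' ->
  path_homotopic (concat p q) (concat p' q').
Proof.
move=> [H [cH H0 H1 Hs]] [K [cK K0 K1 Ks]].
have cs : continuous (fun u : I * I => 2 * itv_val u.1).
  by apply: cts_mul; [exact: cts_cst|exact/cts_val/cts_fst].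
have cs1 : continuous (fun u : I * I => 2 * itv_val u.1 - 1).
  by apply: cts_sub; [exact: cs|exact: cts_cst].
exists (fun u => if 2 * itv_val u.1 - 1 <= 0
                 then H (clamp (2 * itv_val u.1), u.2)
                 else K (clamp (2 * itv_val u.1 - 1), u.2)); split=> /=.
- apply: continuous_if_le0 => //.
  + apply: cts_comp => //; apply: cts_pair; last exact: cts_snd.
    exact: cts_clamp.
  + apply: cts_comp => //; apply: cts_pair; last exact: cts_snd.
    exact: cts_clamp.
  + move=> [t s] /= ts; rewrite clamp_ge1 ?clamp_le0; [|lra|lra].
    by rewrite (Hs s).2 (Ks s).1.
- by move=> t; rewrite concatE /concat_line /path_line /= H0 K0.
- by move=> t; rewrite concatE /concat_line /path_line /= H1 K1.
- move=> s; split.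
    by rewrite itv_val0 mulr0 sub0r lerN10 (Hs s).1.
  rewrite itv_val1 ifF; last by apply/negbTE; lra.
  by rewrite clamp_ge1 ?(Ks s).2 //; lra.
Qed.

Lemma path_homotopic_reverse {x y : X} (p q : {path I from x to y}) :
  path_homotopic p q -> path_homotopic (reverse p) (reverse q).
Proof.
move=> [H [cH H0 H1 Hs]].
exists (fun u => H (clamp (1 - itv_val u.1), u.2)); split=> /=.
- apply: cts_comp => //; apply: cts_pair; last exact: cts_snd.
  apply/cts_clamp/cts_sub; first exact: cts_cst.
  exact/cts_val/cts_fst.
- by move=> t; rewrite H0.
- by move=> t; rewrite H1.
- by move=> s; rewrite itv_val0 itv_val1 subr0 subrr; case: (Hs s).
Qed.

Lemma path_homotopic_reparam {x y : X} (p q : {path I from x to y})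
    (L : R -> X) (f g : R -> R) :
  continuous L -> continuous f -> continuous g -> f 0 = g 0 -> f 1 = g 1 ->
  (forall t, 0 <= t <= 1 -> path_line p t = L (f t)) ->
  (forall t, 0 <= t <= 1 -> path_line q t = L (g t)) ->
  path_homotopic p q.
Proof.
move=> cL cf cg fg0 fg1 pL qL.
have itvP (t : I) : 0 <= itv_val t <= 1 by rewrite itv_val_ge0 itv_val_le1.
exists (fun u => L ((1 - itv_val u.2) * f (itv_val u.1)
                    + itv_val u.2 * g (itv_val u.1))); split=> /=.
- have c1 : continuous (fun u : I * I => itv_val u.1) by exact/cts_val/cts_fst.
  have c2 : continuous (fun u : I * I => itv_val u.2) by exact/cts_val/cts_snd.
  apply: cts_comp => //; apply: cts_add; apply: cts_mul => //.
  + by apply: cts_sub => //; exact: cts_cst.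
  + exact: (cts_comp cf).
  + exact: (cts_comp cg).
- by move=> t; rewrite itv_val0 subr0 mul1r mul0r addr0 path_lineE pL.
- by move=> t; rewrite itv_val1 subrr mul1r mul0r add0r path_lineE qL.
- have E (a b : R) : (1 - a) * b + a * b = b by ring.
  move=> s; rewrite itv_val0 itv_val1 fg0 fg1 !E -!qL ?lexx ?ler01 //.
  by rewrite path_line_le0 // path_line_ge1.
Qed.

Lemma concat_lineE {x y z : X} (p : {path I from x to y})
    (q : {path I from y to z}) (t : R) : 0 <= t <= 1 ->
  path_line (concat p q) t = concat_line p q (2 * t).
Proof. by move=> /andP[t0 t1]; rewrite {1}/path_line /= concatE clampK. Qed.

Lemma path_homotopic_concatA {w x y z : X} (p : {path I from w to x})
    (q : {path I from x to y}) (r : {path I from y to z}) :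
  path_homotopic (concat p (concat q r)) (concat (concat p q) r).
Proof.
pose L (t : R) := if t - 1 <= 0 then path_line p t
                  else concat_line q r (t - 1).
have cB1 : continuous (fun t : R => t - 1).
  by apply: cts_sub; [exact: cts_id|exact: cts_cst].
have cM (a : R) : continuous (fun t : R => a * t).
  by apply: cts_mul; [exact: cts_cst|exact: cts_id].
have cL : continuous L.
  apply: continuous_if_le0 => //; first exact: path_line_continuous.
    by apply: cts_comp => //; exact: concat_line_continuous.
  move=> t t1; rewrite t1 path_line_ge1 /concat_line; last lra.
  by rewrite ifT ?path_line_le0 //; lra.
apply: (@path_homotopic_reparam _ _ _ _ L
  (fun t => Num.max (2 * t) (4 * t - 1))
  (fun t => Num.min (4 * t) (2 * t + 1))).
- exact: cL.
- apply: cts_max; first exact: cM.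
  by apply: cts_sub; [exact: cM|exact: cts_cst].
- apply: cts_min; first exact: cM.
  by apply: cts_add; [exact: cM|exact: cts_cst].
- by rewrite (max_idPl _) ?(min_idPl _); lra.
- by rewrite (max_idPr _) ?(min_idPr _); lra.
- move=> t /andP[t0 t1]; rewrite concat_lineE ?t0 ?t1 // {1}/concat_line.
  have [t2|t2] := leP (2 * t - 1) 0.
    rewrite (max_idPl _) ?/L ?ifT //; lra.
  rewrite (max_idPr _) /L; last lra.
  rewrite ifF; last by apply/negbTE; lra.
  rewrite concat_lineE; last by apply/andP; lra.
  by congr concat_line; lra.
- move=> t /andP[t0 t1]; rewrite concat_lineE ?t0 ?t1 // {1}/concat_line.
  have [t2|t2] := leP (2 * t - 1) 0.
    rewrite (min_idPl _); last lra.
    rewrite concat_lineE; last by apply/andP; lra.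
    rewrite (_ : 2 * (2 * t) = 4 * t); last lra.
    rewrite /L {1}/concat_line; case: ifPn => // t3.
    by rewrite /concat_line ifT //; lra.
  rewrite (min_idPr _) /L; last lra.
  rewrite ifF; last by apply/negbTE; lra.
  rewrite /concat_line ifF; last by apply/negbTE; lra.
  by congr path_line; lra.
Qed.

Lemma path_homotopic_cst_concat {x y : X} (p : {path I from x to y}) :
  path_homotopic (concat (cst_path x) p) p.
Proof.
apply: (@path_homotopic_reparam _ _ _ _ (path_line p)
  (fun t => Num.max 0 (2 * t - 1)) id).
- exact: path_line_continuous.
- apply: cts_max; first exact: cts_cst.
  apply: cts_sub; last exact: cts_cst.
  by apply: cts_mul; [exact: cts_cst|exact: cts_id].
- exact: cts_id.
- by rewrite (max_idPl _); lra.
- by rewrite (max_idPr _); lra.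
- move=> t /andP[t0 t1]; rewrite concat_lineE ?t0 ?t1 // /concat_line.
  have [t2|t2] := leP (2 * t - 1) 0.
    by rewrite [RHS]path_line_le0.
  by [].
- by [].
Qed.

Lemma path_homotopic_concat_cst {x y : X} (p : {path I from x to y}) :
  path_homotopic (concat p (cst_path y)) p.
Proof.
apply: (@path_homotopic_reparam _ _ _ _ (path_line p)
  (fun t => Num.min 1 (2 * t)) id).
- exact: path_line_continuous.
- apply: cts_min; first exact: cts_cst.
  by apply: cts_mul; [exact: cts_cst|exact: cts_id].
- exact: cts_id.
- by rewrite (min_idPr _); lra.
- by rewrite (min_idPl _); lra.
- move=> t /andP[t0 t1]; rewrite concat_lineE ?t0 ?t1 // /concat_line.
  have [t2|t2] := leP (2 * t - 1) 0.
    by rewrite (min_idPr _) //; lra.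
  by rewrite (min_idPl _) ?[RHS]path_line_ge1 //; lra.
- by [].
Qed.

Lemma path_homotopic_concat_reverse {x y : X} (p : {path I from x to y}) :
  path_homotopic (concat p (reverse p)) (cst_path x).
Proof.
apply: (@path_homotopic_reparam _ _ _ _ (path_line p)
  (fun t => Num.min (2 * t) (2 - 2 * t)) (fun=> 0)).
- exact: path_line_continuous.
- have cM : continuous (fun t : R => 2 * t).
    by apply: cts_mul; [exact: cts_cst|exact: cts_id].
  apply: cts_min; first exact: cM.
  by apply: cts_sub; [exact: cts_cst|exact: cM].
- exact: cts_cst.
- by rewrite (min_idPl _); lra.
- by rewrite (min_idPr _); lra.
- move=> t /andP[t0 t1]; rewrite concat_lineE ?t0 ?t1 // /concat_line.
  have [t2|t2] := leP (2 * t - 1) 0.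
    by rewrite (min_idPl _) //; lra.
  rewrite (min_idPr _) ?reverse_lineE; last lra.
  by congr path_line; lra.
- by move=> t _; rewrite [RHS]path_line_le0.
Qed.

Lemma path_homotopic_reverse_concat {x y : X} (p : {path I from x to y}) :
  path_homotopic (concat (reverse p) p) (cst_path y).
Proof.
apply: (@path_homotopic_reparam _ _ _ _ (path_line p)
  (fun t => Num.max (1 - 2 * t) (2 * t - 1)) (fun=> 1)).
- exact: path_line_continuous.
- have cM : continuous (fun t : R => 2 * t).
    by apply: cts_mul; [exact: cts_cst|exact: cts_id].
  apply: cts_max.
    by apply: cts_sub; [exact: cts_cst|exact: cM].
  by apply: cts_sub; [exact: cM|exact: cts_cst].
- exact: cts_cst.
- by rewrite (max_idPl _); lra.
- by rewrite (max_idPr _); lra.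
- move=> t /andP[t0 t1]; rewrite concat_lineE ?t0 ?t1 // /concat_line.
  have [t2|t2] := leP (2 * t - 1) 0.
    by rewrite (max_idPl _) ?reverse_lineE //; lra.
  by rewrite (max_idPr _) //; lra.
- by move=> t _; rewrite [RHS]path_line_ge1.
Qed.

End Paths.

Section FundamentalGroup.
Context (R : realType) (X : topologicalType) (x : X).
Local Notation I := (unit_itv R).

Definition loop : Type := {path I from x to x}.

HB.instance Definition _ := Choice.on loop.

Definition loop_rel (p q : loop) : bool := `[< path_homotopic p q >].

Fact loop_rel_refl : reflexive loop_rel.
Proof. by move=> p; apply/asboolP; exact: path_homotopic_refl. Qed.

Fact loop_rel_sym : symmetric loop_rel.
Proof.
move=> p q; apply/idP/idP => /asboolP pq; apply/asboolP;
exact: path_homotopic_sym.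
Qed.

Fact loop_rel_trans : transitive loop_rel.
Proof.
move=> q p r /asboolP pq /asboolP qr; apply/asboolP.
exact: path_homotopic_trans pq qr.
Qed.

Definition loop_equiv := EquivRel _ loop_rel_refl loop_rel_sym loop_rel_trans.

Definition pi1 := {eq_quot loop_equiv}.

HB.instance Definition _ := Choice.on pi1.
HB.instance Definition _ := Quotient.on pi1.

Definition loop_class (p : loop) : pi1 := \pi_pi1 p.

Lemma loop_classP (p q : loop) :
  loop_class p = loop_class q <-> path_homotopic p q.
Proof. by split=> [/eqmodP/asboolP//|pq]; apply/eqmodP/asboolP. Qed.

Lemma loop_class_repr (a : pi1) : loop_class (repr a) = a.
Proof. exact: reprK. Qed.

Lemma path_homotopic_repr (p : loop) : path_homotopic (repr (loop_class p)) p.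
Proof. by apply/loop_classP; rewrite loop_class_repr. Qed.

Definition pi1_mul (a b : pi1) : pi1 := loop_class (concat (repr a) (repr b)).
Definition pi1_one : pi1 := loop_class (cst_path x).
Definition pi1_inv (a : pi1) : pi1 := loop_class (reverse (repr a)).

Lemma pi1_mulE (p q : loop) :
  pi1_mul (loop_class p) (loop_class q) = loop_class (concat p q).
Proof.
by apply/loop_classP/path_homotopic_concat; exact: path_homotopic_repr.
Qed.

Lemma pi1_invE (p : loop) : pi1_inv (loop_class p) = loop_class (reverse p).
Proof.
by apply/loop_classP/path_homotopic_reverse; exact: path_homotopic_repr.
Qed.

Fact pi1_mulA : associative pi1_mul.
Proof.
move=> a b c; rewrite -(loop_class_repr a) -(loop_class_repr b).
rewrite -(loop_class_repr c) !pi1_mulE.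
exact/loop_classP/path_homotopic_concatA.
Qed.

Fact pi1_mul1 : left_id pi1_one pi1_mul.
Proof.
move=> a; rewrite -(loop_class_repr a) pi1_mulE.
exact/loop_classP/path_homotopic_cst_concat.
Qed.

Fact pi1_mulr1 : right_id pi1_one pi1_mul.
Proof.
move=> a; rewrite -(loop_class_repr a) pi1_mulE.
exact/loop_classP/path_homotopic_concat_cst.
Qed.

Fact pi1_mulV : left_inverse pi1_one pi1_inv pi1_mul.
Proof.
move=> a; rewrite -(loop_class_repr a) pi1_invE pi1_mulE.
exact/loop_classP/path_homotopic_reverse_concat.
Qed.

Fact pi1_mulVr : right_inverse pi1_one pi1_inv pi1_mul.
Proof.
move=> a; rewrite -(loop_class_repr a) pi1_invE pi1_mulE.
exact/loop_classP/path_homotopic_concat_reverse.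
Qed.

HB.instance Definition _ := isGroup.Build pi1
  pi1_mulA pi1_mul1 pi1_mulr1 pi1_mulV pi1_mulVr.

End FundamentalGroup.

Section InducedMap.
Context (R : realType) (X Y : topologicalType) (f : continuousType X Y) (x : X).

Definition pi1_map (a : pi1 R x) : pi1 R (f x) := loop_class (f \o repr a).

Lemma path_homotopic_comp (p q : loop R x) :
  path_homotopic p q -> @path_homotopic R Y (f x) (f x) (f \o p) (f \o q).
Proof.
move=> [H [cH H0 H1 Hs]]; exists (f \o H); split=> /=.
- exact: (cts_comp (@cts_fun _ _ f) cH).
- by move=> t; rewrite H0.
- by move=> t; rewrite H1.
- by move=> s; have [-> ->] := Hs s.
Qed.

Lemma pi1_mapE (p : loop R x) : pi1_map (loop_class p) = loop_class (f \o p).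
Proof. exact/loop_classP/path_homotopic_comp/path_homotopic_repr. Qed.

Fact pi1_mapM : {morph pi1_map : a b / (a * b)%g}.
Proof.
move=> a b; rewrite -(loop_class_repr a) -(loop_class_repr b).
rewrite [X in pi1_map X](pi1_mulE (repr a) (repr b)) !pi1_mapE [RHS]pi1_mulE.
congr loop_class; apply/path_eqP => t; rewrite /= !concatE /concat_line.
by rewrite [in LHS]fun_if.
Qed.

HB.instance Definition _ := isMultiplicative.Build _ _ pi1_map pi1_mapM.

End InducedMap.

Section StdSimplex.
Context {R : realType}.

Definition std_simplex (n : nat) : Type := set_type
  [set t : 'rV[R]_n.+1 | (forall j, 0 <= t ord0 j) /\ \sum_j t ord0 j = 1].

HB.instance Definition _ n := Topological.on (std_simplex n).

Definition coface_fun n (i : 'I_n.+2) (t : 'rV[R]_n.+1) : 'rV[R]_n.+2 :=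
  \row_j if unlift i j is Some k then t ord0 k else 0.

Fact coface_subproof n (i : 'I_n.+2) (t : std_simplex n) :
  coface_fun i (\val t) \in
    [set t : 'rV[R]_n.+2 | (forall j, 0 <= t ord0 j) /\ \sum_j t ord0 j = 1].
Proof.
have [t0 t1] := set_valP t; rewrite inE /=; split=> [j|].
  by rewrite mxE; case: unliftP => [k _|_]; [exact: t0|].
rewrite (bigD1_ord i) //= mxE unlift_none add0r -[RHS]t1.
by apply: eq_bigr => j _; rewrite mxE liftK.
Qed.

Definition coface n (i : 'I_n.+2) (t : std_simplex n) : std_simplex n.+1 :=
  exist (fun u => u \in _) _ (coface_subproof i t).

Lemma cts_mx (T : topologicalType) m n (f : T -> 'M[R]_(m, n)) :
  (forall i j, continuous (fun t => f t i j)) -> continuous f.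
Proof.
move=> cf t A [P nP PA]; near_simpl; near=> u; apply: PA => i j.
move: i j; near: u; apply: filter_forall => i; apply: filter_forall => j.
exact: cf (nP i j).
Unshelve. all: by end_near. Qed.

Lemma cts_coord (m n : nat) (i : 'I_m) (j : 'I_n) :
  continuous (fun A : 'M[R]_(m, n) => A i j).
Proof. exact: coord_continuous. Qed.

Fact coface_continuous n (i : 'I_n.+2) : continuous (coface i).
Proof.
apply: continuous_comp_initial; apply: cts_mx => k j.
rewrite (_ : (fun _ => _) = fun t : std_simplex n =>
    if unlift i j is Some l then \val t ord0 l else 0); last first.
  by apply/funext => t; rewrite /= mxE.
case: unlift => [l|]; last exact: cts_cst.
apply: (cts_comp (@cts_coord _ _ ord0 l)); exact: initial_continuous.
Qed.

HB.instance Definition _ n (i : 'I_n.+2) :=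
  isContinuous.Build _ _ (coface i) (@coface_continuous n i).

End StdSimplex.

Arguments std_simplex : clear implicits.

Definition sing (R : realType) (X : topologicalType) (n : nat) : Type :=
  continuousType (std_simplex R n) X.

HB.instance Definition _ R X n := Choice.on (sing R X n).

Definition sface {R : realType} {X : topologicalType} {n : nat} (i : 'I_n.+2)
  (s : sing R X n.+1) : sing R X n := s \o coface i.

(* A cochain is a homomorphism to Z from the free abelian group on the        *)
(* singular simplices, given here by its values on the simplices.             *)

Section Cohomology.
Context {R : realType}.
Implicit Types X Y : topologicalType.

Definition cochain X (n : nat) : Type := sing R X n -> int.

Definition coboundary X n (c : cochain X n) : cochain X n.+1 :=
  fun s => \sum_(i < n.+2) (-1) ^+ i * c (sface i s).

Definition is_cocycle X n (c : cochain X n) : Prop :=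
  forall s, coboundary c s = 0.

(* A cocycle c satisfies is_coboundary c iff [c] = 0 in H^(n+1)(X; Z).        *)
Definition is_coboundary X n (c : cochain X n.+1) : Prop :=
  exists b : cochain X n, forall s, c s = coboundary b s.

Definition pullback X Y n (f : continuousType X Y) (c : cochain Y n) :
  cochain X n := fun s => c (f \o s).

(* [c] generates the group H^(n+1)(X; Z): every class is a multiple of [c].   *)
Definition generating_cocycle X n (c : cochain X n.+1) : Prop :=
  is_cocycle c /\
  forall c' : cochain X n.+1, is_cocycle c' ->
    exists k : int, is_coboundary (fun s => c' s - k * c s).

End Cohomology.

Arguments cochain : clear implicits.

Section Homology.
Context {R : realType} {X : topologicalType}.

Definition chain (n : nat) : Type := {freeg (sing R X n) / int}.

HB.instance Definition _ n := GRing.Lmodule.on (chain n).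

Definition boundary n (c : chain n.+1) : chain n :=
  fglift (fun s => \sum_(i < n.+2) (-1) ^+ i *: << sface i s >> : chain n) c.

Definition chain_in n (B : set X) (c : chain n) : Prop :=
  forall s, s \in dom c -> range s `<=` B.

(* A chain whose boundary lies in B represents a class of H_(n+1)(X, B; Z);   *)
(* rel_homologous B is equality of such classes, i.e. of chains modulo        *)
(* boundaries and chains in B.                                                *)
Definition rel_cycle n (B : set X) (c : chain n.+1) : Prop :=
  chain_in B (boundary c).

Definition rel_homologous n (B : set X) (c c' : chain n) : Prop :=
  exists d : chain n.+1, chain_in B (c - c' - boundary d).

(* [c] generates H_(n+1)(X, X - {x}; Z). *)
Definition local_generator n (x : X) (c : chain n.+1) : Prop :=
  rel_cycle (~` [set x]) c /\
  forall c' : chain n.+1, rel_cycle (~` [set x]) c' ->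
    exists k : int, rel_homologous (~` [set x]) c' (k *: c).

(* Orientation of a topological (n+1)-manifold: a choice at each x of a       *)
(* generator of H_(n+1)(X, X - {x}; Z), given by a representing chain o x,    *)
(* such that, near each point, these generators are the images of one class   *)
(* of H_(n+1)(X, X - U; Z) for some neighbourhood U of the point.             *)
Definition is_orientation n (o : X -> chain n.+1) : Prop :=
  (forall x, local_generator x (o x)) /\
  forall x : X, exists U : set X, exists c : chain n.+1,
    [/\ nbhs x U, rel_cycle (~` U) c
      & forall y, U y -> rel_homologous (~` [set y]) c (o y)].

End Homology.

Arguments chain : clear implicits.

Definition homeomorphic (X Y : topologicalType) : Prop :=
  exists (f : X -> Y) (g : Y -> X),
    [/\ continuous f, continuous g, cancel f g & cancel g f].

Definition is_manifold (R : realType) (n : nat) (M : topologicalType) : Prop :=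
  [/\ hausdorff_space M, @second_countable M
    & forall x : M, exists (U : set M) (V : set 'rV[R]_n),
        [/\ open U, U x, open V & homeomorphic (set_type U) (set_type V)]].

Definition S3 (R : realType) : Type := set_type
  [set z : R[i]^o * R[i]^o | `|z.1| ^+ 2 + `|z.2| ^+ 2 = 1].

Definition S2 (R : realType) : Type := set_type
  [set p : R * R * R | p.1.1 ^+ 2 + p.1.2 ^+ 2 + p.2 ^+ 2 = 1].

HB.instance Definition _ (R : realType) := Topological.on (S3 R).
HB.instance Definition _ (R : realType) := Topological.on (S2 R).

Section Hopf.
Context {R : realType}.

Definition S3_val (z : S3 R) : R[i] * R[i] := \val z.
Definition S2_val (p : S2 R) : R * R * R := \val p.

Fact S3_pt_subproof : ((1, 0) : R[i]^o * R[i]^o) \in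
  [set z : R[i]^o * R[i]^o | `|z.1| ^+ 2 + `|z.2| ^+ 2 = 1].
Proof. by rewrite inE /= normr1 normr0 expr1n expr0n addr0. Qed.

Definition S3_pt : S3 R := exist (fun z => z \in _) _ S3_pt_subproof.

Fact S2_pt_subproof : ((0, 0, 1) : R * R * R) \in
  [set p : R * R * R | p.1.1 ^+ 2 + p.1.2 ^+ 2 + p.2 ^+ 2 = 1].
Proof. by rewrite inE /= !expr0n expr1n !add0r. Qed.

Definition S2_pt : S2 R := exist (fun p => p \in _) _ S2_pt_subproof.

(* The point [z1, z2] of the complex projective line is identified with the   *)
(* inverse stereographic projection, from (0, 0, 1), of z1 / z2 : for         *)
(* |z1|^2 + |z2|^2 = 1 this is (2 z1 conj(z2), |z1|^2 - |z2|^2) in C x R.     *)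
Definition hopf_fun (z : R[i] * R[i]) : R * R * R :=
  let w := 2 * z.1 * conjc z.2 in
  (complex.Re w, complex.Im w, complex.Re (`|z.1| ^+ 2 - `|z.2| ^+ 2)).

Lemma S3P (z : S3 R) : `|(S3_val z).1| ^+ 2 + `|(S3_val z).2| ^+ 2 = 1.
Proof. exact: (set_valP z). Qed.

Lemma S2P (p : S2 R) :
  (S2_val p).1.1 ^+ 2 + (S2_val p).1.2 ^+ 2 + (S2_val p).2 ^+ 2 = 1.
Proof. exact: (set_valP p). Qed.

Lemma hopf_funE (a b c d : R) : hopf_fun (a +i* b, c +i* d) =
  (2 * (a * c + b * d), 2 * (b * c - a * d),
   a ^+ 2 + b ^+ 2 - (c ^+ 2 + d ^+ 2)).
Proof.
rewrite /hopf_fun -!add_Re2_Im2 /=; congr (_, _, _); ring.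
Qed.

Fact hopf_subproof (z : S3 R) : hopf_fun (S3_val z) \in
  [set p : R * R * R | p.1.1 ^+ 2 + p.1.2 ^+ 2 + p.2 ^+ 2 = 1].
Proof.
have := S3P z; case: (S3_val z) => [[a b] [c d]].
rewrite inE hopf_funE -!add_Re2_Im2 /= => -[zE _].
transitivity ((a ^+ 2 + b ^+ 2 + (c ^+ 2 + d ^+ 2)) ^+ 2); first ring.
by rewrite zE expr1n.
Qed.

Definition hopf (z : S3 R) : S2 R :=
  exist (fun p => p \in _) _ (hopf_subproof z).

Lemma hopf_val (z : S3 R) : S2_val (hopf z) = hopf_fun (S3_val z).
Proof. by []. Qed.

Lemma hopf_pt : hopf S3_pt = S2_pt.
Proof.
apply/val_inj; rewrite [LHS](hopf_funE 1 0 0 0) /=; congr (_, _, _); ring.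
Qed.

(* Together with hopf_surj: S2 is the quotient of S3 by the unit complex      *)
(* numbers, that is, the complex projective line.                             *)
Lemma hopf_fiber (z w : S3 R) : hopf z = hopf w <->
  exists l : R[i], `|l| = 1 /\
    S3_val w = (l * (S3_val z).1, l * (S3_val z).2).
Proof.
split.
  move=> /(congr1 S2_val); rewrite !hopf_val.
  have := S3P z; have := S3P w.
  case: (S3_val z) => [[a b] [c d]]; case: (S3_val w) => [[a' b'] [c' d']].
  rewrite /= -!add_Re2_Im2 /= => -[wE _] [zE _].
  rewrite !hopf_funE => -[E1 E2 E3].
  have {}E1 : a * c + b * d = a' * c' + b' * d' by lra.
  have {}E2 : b * c - a * d = b' * c' - a' * d' by lra.
  have E4 : a ^+ 2 + b ^+ 2 = a' ^+ 2 + b' ^+ 2 by lra.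
  have {E3}E5 : c ^+ 2 + d ^+ 2 = c' ^+ 2 + d' ^+ 2 by lra.
  pose x := a' * a + b' * b + (c' * c + d' * d).
  pose y := b' * a - a' * b + (d' * c - c' * d).
  have e1 : x * a - y * b = a'.
    transitivity (a' * (a ^+ 2 + b ^+ 2) + c' * (a * c + b * d)
                  - d' * (b * c - a * d)); first by rewrite /x /y; ring.
    by rewrite E1 E2 E4 -[RHS]mulr1 -wE; ring.
  have e2 : x * b + y * a = b'.
    transitivity (b' * (a ^+ 2 + b ^+ 2) + d' * (a * c + b * d)
                  + c' * (b * c - a * d)); first by rewrite /x /y; ring.
    by rewrite E1 E2 E4 -[RHS]mulr1 -wE; ring.
  have e3 : x * c - y * d = c'.
    transitivity (c' * (c ^+ 2 + d ^+ 2) + a' * (a * c + b * d)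
                  + b' * (b * c - a * d)); first by rewrite /x /y; ring.
    by rewrite E1 E2 E5 -[RHS]mulr1 -wE; ring.
  have e4 : x * d + y * c = d'.
    transitivity (d' * (c ^+ 2 + d ^+ 2) + b' * (a * c + b * d)
                  - a' * (b * c - a * d)); first by rewrite /x /y; ring.
    by rewrite E1 E2 E5 -[RHS]mulr1 -wE; ring.
  exists (x +i* y); split; last by rewrite -e1 -e2 -e3 -e4; simpc.
  rewrite normc_def /= (_ : x ^+ 2 + y ^+ 2 = 1) ?sqrtr1 //.
  rewrite -[LHS]mulr1 -{1}zE -wE -e1 -e2 -e3 -e4; ring.
move=> [l [l1 wE]]; apply/val_inj.
change (hopf_fun (S3_val z) = hopf_fun (S3_val w)); rewrite wE.
have : `|l| ^+ 2 = 1 by rewrite l1 expr1n.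
case: (S3_val z) => [[a b] [c d]]; case: l {l1 wE} => x y.
rewrite -add_Re2_Im2 /= => -[lE]; simpc.
rewrite !hopf_funE; congr (_, _, _).
- by rewrite -[LHS]mulr1 -lE; ring.
- by rewrite -[LHS]mulr1 -lE; ring.
- by rewrite -[LHS]mulr1 -lE; ring.
Qed.

Lemma hopf_surj (p : S2 R) : exists z : S3 R, hopf z = p.
Proof.
have [] : exists z : R[i] * R[i],
    `|z.1| ^+ 2 + `|z.2| ^+ 2 = 1 /\ hopf_fun z = S2_val p; last first.
  move=> z [z1 zE]; exists (exist (fun z => z \in _) z (mem_set z1)).
  exact/val_inj.
have := S2P p; case: (S2_val p) => [[x y] h] /= pE.
have [hN|hN] := eqVneq h (-1).
  have [x0 y0] : x = 0 /\ y = 0.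
    by split; apply/eqP; rewrite -sqrf_eq0; apply/eqP; nra.
  exists (0, 1); split; first by rewrite normr0 normr1 expr0n expr1n add0r.
  by rewrite (hopf_funE 0 0 1 0) x0 y0 hN; congr (_, _, _); ring.
have h1 : 0 < (1 + h) / 2.
  suff : 0 < 1 + h by lra.
  by rewrite lt_neqAle eq_sym addrC addr_eq0 hN; nra.
pose r := Num.sqrt ((1 + h) / 2).
have r0 : r != 0 by rewrite sqrtr_eq0 -ltNge.
have r2 : r ^+ 2 = (1 + h) / 2 by rewrite sqr_sqrtr // ltW.
have hE : h = 2 * r ^+ 2 - 1 by rewrite r2; field.
have xy : x ^+ 2 + y ^+ 2 = 4 * r ^+ 2 * (1 - r ^+ 2).
  move: pE; rewrite hE => pE.
  by rewrite -[LHS](addrK ((2 * r ^+ 2 - 1) ^+ 2)) pE; ring.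
have cd : (x / (2 * r)) ^+ 2 + (- y / (2 * r)) ^+ 2 = 1 - r ^+ 2.
  transitivity ((x ^+ 2 + y ^+ 2) / (4 * r ^+ 2)); first by field.
  by rewrite xy; field.
exists (r +i* 0, (x / (2 * r)) +i* (- y / (2 * r))); split.
  rewrite -!add_Re2_Im2 [X in X + _]/= [X in _ + X]/= cd.
  by apply/eqP; rewrite eq_complex /=; apply/andP; split; apply/eqP; ring.
rewrite hopf_funE cd hE; congr (_, _, _); last by ring.
  by field.
by field.
Qed.

End Hopf.

Definition based_map (M Y : topologicalType) (p0 : M) (y0 : Y) : Type :=
  set_type [set f : {compact-open, M -> Y} | continuous f /\ f p0 = y0].

HB.instance Definition _ M Y p0 y0 := Topological.on (@based_map M Y p0 y0).

Section BasedMaps.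
Context {M Y : topologicalType} {p0 : M} {y0 : Y}.

Fact based_map_continuous (f : based_map p0 y0) : continuous (\val f : M -> Y).
Proof. by have [] := set_valP f. Qed.

Definition map_of (f : based_map p0 y0) : continuousType M Y :=
  mkcts (@based_map_continuous f).

Lemma map_of_pt (f : based_map p0 y0) : map_of f p0 = y0.
Proof. by have [] := set_valP f. Qed.

End BasedMaps.

Section SphereMaps.
Context (R : realType) {M : topologicalType} (p0 : M).

Definition S3_maps : Type := based_map p0 (@S3_pt R).
Definition S2_maps : Type := based_map p0 (@S2_pt R).

HB.instance Definition _ := Topological.on S3_maps.
HB.instance Definition _ := Topological.on S2_maps.

Definition inessential (mu : cochain R (S2 R) 2) : set S2_maps :=
  [set phi | is_coboundary (pullback (map_of phi) mu)].

Definition inessential_maps (mu : cochain R (S2 R) 2) : Type :=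
  set_type (inessential mu).

HB.instance Definition _ mu := Topological.on (inessential_maps mu).

Definition inessential_val (mu : cochain R (S2 R) 2)
  (phi : inessential_maps mu) : S2_maps := \val phi.

End SphereMaps.

(* Main.v *)
(* The circle acts on S^3 with quotient map pi, so a lift of a map M -> S^2 is
   unique up to a map M -> S^1, and such a map has a logarithm M -> R: its
   winding numbers define a homomorphism from the finite group pi_1(M) to Z,
   hence vanish. Paths and homotopies of maps M -> S^2 lift to S^3 because pi
   has an explicit parallel transport between nearby fibres. The end of the lift
   of a loop at rho(psi_0) is exp(i theta) psi_0, so multiplying the lift at time
   t by exp(-i t theta) makes it a loop: rho_* is onto. A homotopy from rho(p) to
   rho(q) lifts to one from p to a loop exp(i theta) q with theta vanishing at
   both ends, which contracts to q: rho_* is injective. Finally, pi \o psi is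
   algebraically inessential because H^2(S^3; Z) = 0; this follows from a cone
   operator on the singular simplices of S^3 of dimension at most 2, which exists
   since a map from the boundary of a simplex of dimension at most 3 to S^3 is
   homotopic to a Lipschitz map, and the latter misses a point. *)
Require Import Defs.
From HB Require Import structures.
From mathcomp Require Import all_boot all_order all_algebra.
From mathcomp Require Import all_classical all_reals all_analysis.
From mathcomp Require Import homotopy.
From mathcomp Require Import complex ring lra zify.

Set Implicit Arguments.
Unset Strict Implicit.
Unset Printing Implicit Defensive.

Import Order.TTheory GRing.Theory Num.Theory.
Import numFieldNormedType.Exports numFieldTopology.Exports.
Local Open Scope classical_set_scope.
Local Open Scope ring_scope.

(** Lifting along the Hopf map and lifting along t |-> exp(i t) are instances of one lemma on a
    transport [l e b] that is defined and continuous for all [e] and [b], but reaches the fibre over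
    [b] for sure only when [b] is close to the image of [e]. Compactness gives a subdivision fine
    enough for every transport that is made. Since [l] fixes [e] when [b] is its own image, a lift
    is stationary wherever the given map is: this keeps lifts of based maps based, and lifted
    homotopies constant at the ends of the loops. The two halves take different logarithms. For
    surjectivity the phase is a function on M, and monodromy has to be excluded. For injectivity it
    is a function on M * I equal to 1 at loop parameter 0, so that its logarithm is lifted along
    this parameter. A Lipschitz approximation is forced because a continuous map from a surface to
    S^3 may be onto. Missing a direction then becomes a count: N^3 directions in R^4 against O(N^2)
    small cells covering the two-dimensional boundary. *)

Section PointwiseContinuity.
Context {R : realType}.

Lemma cts_max_at (T : topologicalType) (f : T -> R) (t : T) (a : R) :
  f @ t --> f t -> (fun u => Num.max a (f u)) @ t --> Num.max a (f t).
Proof.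
move=> cf; have h : continuous (fun y : R => Num.max a y).
  by apply: cts_max; [exact: cts_cst|exact: cts_id].
have k := cvg_comp _ _ cf (h (f t)); exact: k.
Qed.

Section At.
Context {T : topologicalType} {V : normedModType R} (t : T).

(** Pointwise forms are wanted because the projection to the boundary in [boundary_extension] is
    continuous only away from the barycentre. *)
Lemma at_add (f g : T -> V) :
  f @ t --> f t -> g @ t --> g t -> (fun u => f u + g u) @ t --> f t + g t.
Proof. exact: cvgD. Qed.

Lemma at_sub (f g : T -> V) :
  f @ t --> f t -> g @ t --> g t -> (fun u => f u - g u) @ t --> f t - g t.
Proof. exact: cvgB. Qed.

Lemma at_scale (k : T -> R) (f : T -> V) :
  k @ t --> k t -> f @ t --> f t -> (fun u => k u *: f u) @ t --> k t *: f t.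
Proof. exact: cvgZ. Qed.

Lemma at_inv (k : T -> R) :
  k t != 0 -> k @ t --> k t -> (fun u => (k u)^-1) @ t --> (k t)^-1.
Proof. by move=> k0 ck; exact: cvgV. Qed.

End At.

End PointwiseContinuity.

(** * Coordinates on the spheres *)

Section Coordinates.
Context {R : realType}.

Lemma cts_Re : continuous (@complex.Re R : R[i]^o -> R).
Proof.
move=> z; apply/(@cvgrPdist_lt _ _ _ (nbhs (z : R[i]^o))) => e e0.
have e0' : 0 < e%:C%C by rewrite ltcE /= eqxx.
apply: filterS (@nbhsx_ballx _ R[i]^o z _ e0') => w.
rewrite /ball /= -(raddfB (@complex.Re R)).
case: (z - w) => a b.
rewrite normc_def /= ltcR; apply: le_lt_trans.
by rewrite -sqrtr_sqr ler_wsqrtr // lerDl sqr_ge0.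
Qed.

Lemma cts_Im : continuous (@complex.Im R : R[i]^o -> R).
Proof.
move=> z; apply/(@cvgrPdist_lt _ _ _ (nbhs (z : R[i]^o))) => e e0.
have e0' : 0 < e%:C%C by rewrite ltcE /= eqxx.
apply: filterS (@nbhsx_ballx _ R[i]^o z _ e0') => w.
rewrite /ball /= -(raddfB (@complex.Im R)).
case: (z - w) => a b.
rewrite normc_def /= ltcR; apply: le_lt_trans.
by rewrite -sqrtr_sqr ler_wsqrtr // lerDr sqr_ge0.
Qed.

Lemma cts_complex (T : topologicalType) (a b : T -> R) :
  continuous a -> continuous b -> continuous (fun t => (a t +i* b t)%C : R[i]^o).
Proof.
move=> ca cb t; apply/cvgrPdist_lt => -[e e'].
(* Radii in [R[i]] are complex numbers; positivity forces the imaginary part to vanish. *)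
rewrite ltcE /= => /andP[/eqP ->] e0.
have e20 : 0 < e / 2 by lra.
near=> u.
have au : `|a t - a u| < e / 2.
  by near: u; move/cvgrPdist_lt: (ca t); apply.
have bu : `|b t - b u| < e / 2.
  by near: u; move/cvgrPdist_lt: (cb t); apply.
rewrite normc_def /= ltcR -[ltRHS]ger0_norm; last exact: ltW.
rewrite -sqrtr_sqr ltr_sqrt; last nra.
rewrite -(real_normK (num_real (a t - a u))) -(real_normK (num_real (b t - b u))).
have := normr_ge0 (a t - a u); have := normr_ge0 (b t - b u); nra.
Unshelve. all: by end_near. Qed.

Definition s3c (i : 'I_4) (z : S3 R) : R :=
  match val i with
  | 0 => complex.Re (S3_val z).1 | 1 => complex.Im (S3_val z).1
  | 2 => complex.Re (S3_val z).2 | _ => complex.Im (S3_val z).2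
  end.

Lemma S3_val_continuous :
  continuous (S3_val : S3 R -> (R[i]^o * R[i]^o)%type).
Proof. exact: initial_continuous. Qed.

Lemma s3c_continuous i : continuous (s3c i).
Proof.
have c1 : continuous (fun z : S3 R => (S3_val z).1 : R[i]^o).
  exact: (cts_comp (@cts_fst _ _) S3_val_continuous).
have c2 : continuous (fun z : S3 R => (S3_val z).2 : R[i]^o).
  exact: (cts_comp (@cts_snd _ _) S3_val_continuous).
case: i => [[|[|[|i]]] hi]; rewrite /s3c /=.
- exact: (cts_comp cts_Re c1).
- exact: (cts_comp cts_Im c1).
- exact: (cts_comp cts_Re c2).
- exact: (cts_comp cts_Im c2).
Qed.

Definition k0 : 'I_4 := @Ordinal 4 0 isT.
Definition k1 : 'I_4 := @Ordinal 4 1 isT.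
Definition k2 : 'I_4 := @Ordinal 4 2 isT.
Definition k3 : 'I_4 := @Ordinal 4 3 isT.

Lemma ord4_ind (P : 'I_4 -> Prop) : P k0 -> P k1 -> P k2 -> P k3 -> forall i, P i.
Proof.
move=> h0 h1 h2 h3 [i hi]; move: (hi).
case: i hi => [|[|[|[|i]]]] hi hi'; last by move: (hi').
- by rewrite (_ : Ordinal _ = k0) //; apply: val_inj.
- by rewrite (_ : Ordinal _ = k1) //; apply: val_inj.
- by rewrite (_ : Ordinal _ = k2) //; apply: val_inj.
- by rewrite (_ : Ordinal _ = k3) //; apply: val_inj.
Qed.

Lemma s3c_sq z : s3c k0 z ^+ 2 + s3c k1 z ^+ 2 + s3c k2 z ^+ 2 + s3c k3 z ^+ 2 = 1.
Proof.
have := S3P z; rewrite /s3c /=; case: (S3_val z) => [[a b] [c d]] /=.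
by rewrite -!add_Re2_Im2 /= => -[<- _]; ring.
Qed.

Fact S3_mk_subproof (a b c d : R) : a ^+ 2 + b ^+ 2 + c ^+ 2 + d ^+ 2 = 1 ->
  ((a +i* b)%C, (c +i* d)%C) \in
  [set z : R[i]^o * R[i]^o | `|z.1| ^+ 2 + `|z.2| ^+ 2 = 1].
Proof.
move=> h; rewrite inE /= -!add_Re2_Im2 /=; apply/eqP; rewrite eq_complex /=.
by apply/andP; split; apply/eqP; rewrite -?h; ring.
Qed.

Definition S3_mk (a b c d : R) (h : a ^+ 2 + b ^+ 2 + c ^+ 2 + d ^+ 2 = 1) : S3 R :=
  exist (fun z => z \in _) _ (S3_mk_subproof h).

Lemma S3_eq (z w : S3 R) : (forall i, s3c i z = s3c i w) -> z = w.
Proof.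
move=> h; apply/val_inj; change (S3_val z = S3_val w).
have := (h k0, h k1, h k2, h k3); rewrite /s3c /=.
by case: (S3_val z) (S3_val w) => [[a b] [c d]] [[a' b'] [c' d']] /= [[[-> ->] ->] ->].
Qed.

Lemma S3_continuous (T : topologicalType) (f : T -> S3 R) :
  (forall i, continuous (fun t => s3c i (f t))) -> continuous f.
Proof.
move=> cf; apply: continuous_comp_initial.
rewrite (_ : _ \o _ = fun t => ((s3c k0 (f t) +i* s3c k1 (f t))%C : R[i]^o,
                              (s3c k2 (f t) +i* s3c k3 (f t))%C : R[i]^o)).
  by apply: cts_pair; apply: cts_complex; exact: cf.
apply/funext => t; change (S3_val (f t) = ((s3c k0 (f t) +i* s3c k1 (f t))%C : R[i]^o,
                              (s3c k2 (f t) +i* s3c k3 (f t))%C : R[i]^o)).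
by rewrite /s3c /=; case: (S3_val (f t)) => [[a b] [c d]].
Qed.

Lemma S2_val_continuous : continuous (@S2_val R).
Proof. exact: initial_continuous. Qed.

Lemma S2_continuous (T : topologicalType) (f : T -> S2 R) :
  continuous (fun t => (S2_val (f t)).1.1) ->
  continuous (fun t => (S2_val (f t)).1.2) ->
  continuous (fun t => (S2_val (f t)).2) -> continuous f.
Proof.
move=> c1 c2 c3; apply: continuous_comp_initial.
rewrite (_ : _ \o _ = fun t => ((S2_val (f t)).1.1, (S2_val (f t)).1.2, (S2_val (f t)).2)).
  by apply: cts_pair => //; apply: cts_pair.
by apply/funext => t; rewrite -!surjective_pairing.
Qed.

Lemma hopf_coord (z : S3 R) : S2_val (hopf z) =
  (2 * (s3c k0 z * s3c k2 z + s3c k1 z * s3c k3 z),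
   2 * (s3c k1 z * s3c k2 z - s3c k0 z * s3c k3 z),
   s3c k0 z ^+ 2 + s3c k1 z ^+ 2 - (s3c k2 z ^+ 2 + s3c k3 z ^+ 2)).
Proof.
by rewrite hopf_val /s3c /=; case: (S3_val z) => [[a b] [c d]]; rewrite hopf_funE.
Qed.

Lemma cts_sq (T : topologicalType) (f : T -> R) :
  continuous f -> continuous (fun t => f t ^+ 2).
Proof. by move=> cf; apply: (cts_mul cf cf). Qed.

Lemma hopf_continuous : continuous (@hopf R).
Proof.
have c i := s3c_continuous i.
apply: S2_continuous.
- rewrite (_ : (fun _ => _) = fun z => 2 * (s3c k0 z * s3c k2 z + s3c k1 z * s3c k3 z)).
    by apply: cts_mul; [exact: cts_cst|apply: cts_add; apply: cts_mul; exact: c].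
  by apply/funext => z; rewrite hopf_coord.
- rewrite (_ : (fun _ => _) = fun z => 2 * (s3c k1 z * s3c k2 z - s3c k0 z * s3c k3 z)).
    by apply: cts_mul; [exact: cts_cst|apply: cts_sub; apply: cts_mul; exact: c].
  by apply/funext => z; rewrite hopf_coord.
- rewrite (_ : (fun _ => _) = fun z =>
    s3c k0 z ^+ 2 + s3c k1 z ^+ 2 - (s3c k2 z ^+ 2 + s3c k3 z ^+ 2)).
    by apply: cts_sub; apply: cts_add; apply: cts_sq; exact: c.
  by apply/funext => z; rewrite hopf_coord.
Qed.

End Coordinates.

(** * Lipschitz approximation *)

Section LipschitzApproximation.
Context {R : realType}.

Lemma rV_norm_leP d (x : 'rV[R]_d) (c : R) : 0 <= c ->
  (`|x| <= c) <-> (forall j, `|x ord0 j| <= c).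
Proof.
move=> c0.
rewrite /Num.norm /= mx_normrE; split.
  by move=> /bigmax_leP[_ h] j; exact: (h (ord0, j)).
by move=> h; apply/bigmax_leP; split=> // -[i j] _ /=; rewrite ord1; exact: h.
Qed.

(** Heine-Cantor relative to a compact subset, by the near-covering form of compactness with [d]
    tending to 0 from the right. *)
Lemma compact_uniform_continuity {V : normedModType R} (K : set V) (f : V -> R)
    (e : R) : compact K -> {within K, continuous f} -> 0 < e ->
  exists2 d, 0 < d & forall x y, K x -> K y -> `|x - y| < d -> `|f x - f y| < e.
Proof.
move=> /compact_near_coveringP/near_covering_withinP cK /subspace_continuousP cf e0.
have : \forall d \near (0:R)^'+, K `<=`
    [set x | forall y, K y -> `|x - y| < d -> `|f x - f y| < e].
  apply: cK => x Kx.
  have e2 : 0 < e / 2 by lra.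
  have [r r0 hr] : exists2 r : R, 0 < r &
      forall y, K y -> `|x - y| < r -> `|f x - f y| < e / 2.
    have /cvgrPdist_lt/(_ _ e2) := cf x Kx.
    rewrite nearE /within /= => /nbhs_normP[r /= r0 hr].
    by exists r => // y Ky xy; exact: hr.
  have r2 : 0 < r / 2 by lra.
  exists (ball x (r / 2), [set d | 0 < d < r / 2]).
    split; first exact: nbhsx_ballx.
    near=> d => /=; apply/andP; split; near: d; first exact: nbhs_right_gt.
    exact: nbhs_right_lt.
  move=> [x' d] /=; rewrite -ball_normE /= => -[xx' /andP[d0 dr]] Kx' y Ky x'y.
  have h1 : `|f x - f x'| < e / 2 by apply: hr => //; lra.
  have h2 : `|f x - f y| < e / 2.
    by apply: hr => //; have := ler_distD x' x y; lra.
  have := ler_distD (f x) (f x') (f y); rewrite (distrC (f x') (f x)); lra.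
move=> H; near (0:R)^'+ => d.
have h : K `<=` [set x | forall y, K y -> `|x - y| < d -> `|f x - f y| < e] by near: d.
by exists d => // x y /h; apply.
Unshelve. all: by end_near. Qed.

(* g x = inf_(y in K) (f y + L |x - y|) is L-Lipschitz. *)
Lemma lipschitz_approx {V : normedModType R} (K : set V) (f : V -> R) (e : R) :
  compact K -> {within K, continuous f} -> 0 < e ->
  exists (g : V -> R) (L : R), [/\ 0 < L,
    forall x y, `|g x - g y| <= L * `|x - y| &
    forall x, K x -> `|f x - g x| <= e].
Proof.
move=> cK cf e0.
have [->|/set0P[z Kz]] := eqVneq K set0.
  by exists (fun=> 0), 1; split=> // x y; rewrite subrr normr0 mul1r.
have [d d0 fd] := compact_uniform_continuity cK cf e0.
have [M M0 fM] : exists2 M, 0 < M & forall x, K x -> `|f x| <= M.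
  have /compact_bounded[M [_ hM]] : compact (f @` K).
    exact: continuous_compact.
  exists (`|M| + 1) => [|x Kx]; first by have := normr_ge0 M; lra.
  by apply: (hM (`|M| + 1)); [have := ler_norm M; lra|exists x].
(* A point [y] at distance at least [d] from [x] pays a penalty of at least 2 M, so its term is not
   below f x; only points where [f] is within [e] of f x can lower the infimum. *)
pose L := 2 * M / d.
have L0 : 0 < L by rewrite /L divr_gt0 //; lra.
have Ld : L * d = 2 * M by rewrite /L; field; lra.
pose E x := [set f y + L * `|x - y| | y in K].
have Elb x : has_lbound (E x).
  exists (- M) => _ [y Ky <-].
  have := fM _ Ky; rewrite ler_norml => /andP[h _].
  have : 0 <= L * `|x - y| by rewrite mulr_ge0 // ltW.
  lra.
have E0 x : E x !=set0 by exists (f z + L * `|x - z|); exists z.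
pose g x := inf (E x).
have gle x y : g x <= g y + L * `|x - y|.
  rewrite -lerBlDr; apply: lb_le_inf => // _ [w Kw <-].
  have : g x <= f w + L * `|x - w| by apply: ge_inf => //; exists w.
  have := ler_distD y x w; rewrite -(ler_pM2l L0) mulrDr; lra.
exists g, L; split=> //.
  move=> x y; rewrite ler_norml; have := gle x y; have := gle y x.
  by rewrite (distrC y); lra.
move=> x Kx.
have h1 : g x <= f x.
  apply: ge_inf => //; exists x => //; rewrite subrr normr0 mulr0; lra.
have h2 : f x - e <= g x.
  apply: lb_le_inf => // _ [y Ky <-].
  have [xy|xy] := ltP `|x - y| d.
    have := fd _ _ Kx Ky xy; rewrite ltr_norml => /andP[_ ?].
    have : 0 <= L * `|x - y| by rewrite mulr_ge0 // ltW.
    lra.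
  have : L * d <= L * `|x - y| by rewrite ler_pM2l.
  have := fM _ Kx; have := fM _ Ky; rewrite !ler_norml => /andP[? _] /andP[_ ?].
  lra.
rewrite ger0_norm; lra.
Qed.

Lemma lipschitz_approx_rV {V : normedModType R} d (K : set V) (f : V -> 'rV[R]_d) (e : R) :
  compact K -> {within K, continuous f} -> 0 < e ->
  exists (g : V -> 'rV[R]_d) (L : R), [/\ 0 < L,
    forall x y, `|g x - g y| <= L * `|x - y| &
    forall x, K x -> `|f x - g x| <= e].
Proof.
move=> cK cf e0.
have cfj j : {within K, continuous (fun x => f x ord0 j)}.
  apply/subspace_continuousP => x Kx; move/subspace_continuousP: cf => cf.
  have h := cvg_comp _ _ (cf x Kx) (@cts_coord _ _ _ ord0 j (f x)).
  exact: h.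
have /choice[g /choice[L h]] j := lipschitz_approx cK (cfj j) e0.
pose M := \sum_j L j + 1.
have L0 j : 0 < L j by have [] := h j.
have LM j : L j <= M.
  rewrite /M (bigD1 j) //=.
  have : 0 <= \sum_(i < d | i != j) L i by apply: sumr_ge0 => i _; exact: ltW.
  lra.
have M0 : 0 < M.
  have : 0 <= \sum_(i < d) L i by apply: sumr_ge0 => i _; exact: ltW.
  rewrite /M; lra.
exists (fun x => \row_j g j x), M; split=> //.
  move=> x y; apply/rV_norm_leP; first by rewrite mulr_ge0 // ltW.
  move=> j; rewrite !mxE; have [_ + _] := h j => /(_ x y)/le_trans; apply.
  by rewrite ler_wpM2r.
move=> x Kx; apply/rV_norm_leP; first exact: ltW.
by move=> j; rewrite !mxE; have [_ _] := h j; apply.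
Qed.

Lemma lipschitz_continuous (V W : normedModType R) (g : V -> W) (L : R) : 0 < L ->
  (forall x y, `|g x - g y| <= L * `|x - y|) -> continuous g.
Proof.
move=> L0 h x; apply/cvgrPdist_lt => e e0.
have eL : 0 < e / L by rewrite divr_gt0.
apply: filterS (nbhsx_ballx x _ eL) => y; rewrite -ball_normE /= => xy.
apply: (le_lt_trans (h _ _)); by rewrite mulrC -ltr_pdivlMr.
Qed.

End LipschitzApproximation.

(** * Rays missed by a Lipschitz map *)

Section MissedRay.
Context {R : realType}.

(* Upper box dimension at most 2, witnessed by the cells [set x | c x = t]. *)
Definition box_dim2 {V : normedModType R} (K : set V) : Prop :=
  exists C : nat, forall n : nat, exists (T : finType) (c : V -> T),
    (#|T| <= C * n.+1 ^ 2)%N /\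
    forall x y, K x -> K y -> c x = c y -> n%:R * `|x - y| <= 2.

(* The N^3 rays through the points (a, b, c, 1) with a, b, c in (1/N){0..N-1}
   are pairwise far apart outside the d-ball, too many for the O(n^2) cells. *)
Lemma missed_ray {V : normedModType R} (K : set V) (g : V -> 'rV[R]_4) (L d : R) :
  box_dim2 K -> 0 < L -> 0 < d ->
  (forall x y, `|g x - g y| <= L * `|x - y|) ->
  (forall x, K x -> d <= `|g x|) ->
  exists2 v : 'rV[R]_4, v != 0 & forall x s, K x -> 0 <= s -> g x != s *: v.
Proof.
move=> [C hC] L0 d0 gL gd; apply: contrapT => nex.
(* With k d > 4 L, two directions that are hit from a common cell at scale k N differ by less than
   1/N, hence coincide. *)
pose k := Num.bound (4 * L / d).
have kP : 4 * L < k%:R * d.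
  rewrite -ltr_pdivrMr //; apply: le_lt_trans (archi_boundP _); first by [].
  by rewrite ltW // divr_gt0 // mulr_gt0.
(* At scale k N there are at most C (k N + 1)^2 <= C ((k + 1) N)^2 cells, fewer than N^3 because N
   exceeds C (k + 1)^2. *)
pose N := (C * k.+1 ^ 2).+1.
(* The default of [nth] supplies the fourth coordinate 1, so every [v a] has maximum norm 1. *)
pose v (a : 'I_N * 'I_N * 'I_N) : 'rV[R]_4 :=
  \row_j nth 1 [:: a.1.1%:R / N%:R; a.1.2%:R / N%:R; a.2%:R / N%:R] j.
have N0 : 0 < N%:R :> R by rewrite ltr0n.
have vn a : `|v a| = 1.
  apply/eqP; rewrite eq_le; apply/andP; split.
    apply/rV_norm_leP => //; apply: ord4_ind; rewrite mxE /= ?normr1 //.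
    - by rewrite ger0_norm ?divr_ge0 // ler_pdivrMr // mul1r ler_nat ltnW.
    - by rewrite ger0_norm ?divr_ge0 // ler_pdivrMr // mul1r ler_nat ltnW.
    - by rewrite ger0_norm ?divr_ge0 // ler_pdivrMr // mul1r ler_nat ltnW.
  have /rV_norm_leP : `|v a| <= `|v a| by [].
  by move=> /(_ (normr_ge0 _) k3); rewrite mxE /= normr1.
have v0 a : v a != 0 by rewrite -normr_eq0 vn oner_eq0.
have vsep a b : N%:R * `|v a - v b| < 1 -> a = b.
  move=> h.
  have hj j : N%:R * `|v a ord0 j - v b ord0 j| < 1.
    apply: le_lt_trans h; rewrite ler_pM2l //.
    have /rV_norm_leP : `|v a - v b| <= `|v a - v b| by [].
    by move=> /(_ (normr_ge0 _) j); rewrite !mxE.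
  have E (p q : nat) : N%:R * `|p%:R / N%:R - q%:R / N%:R| < 1 :> R -> p = q.
    rewrite -{1}(ger0_norm (ltW N0)) -normrM mulrBr !(mulrC N%:R) !divfK ?gt_eqF //.
    wlog pq : p q / (p <= q)%N.
      move=> W; have /orP[pq|pq] := leq_total p q; first exact: W.
      by rewrite distrC => /(W _ _ pq) ->.
    rewrite distrC -natrB // normr_nat (ltr_nat _ _ 1) => qp.
    by apply/eqP; rewrite eqn_leq pq -subn_eq0; lia.
  have := (hj k0, hj k1, hj k2); rewrite !mxE /= => -[[/E h0 /E h1] /E h2].
  case: a b {h hj} h0 h1 h2 => [[a0 a1] a2] [[b0 b1] b2] /= h0 h1 h2.
  by congr (_, _, _); apply: val_inj.
have /choice[x /choice[s hx]] a : exists x s, [/\ K x, 0 <= s & g x = s *: v a].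
  apply: contrapT => h; apply: nex; exists (v a) => // x s Kx s0.
  by apply/eqP => gx; apply: h; exists x, s.
have [T [c [cT cP]]] := hC (k * N)%N.
have inj : injective (fun a => c (x a)).
  move=> a b /= cab; apply: vsep.
  have [Ka sa ga] := hx a; have [Kb sb gb] := hx b.
  have := cP _ _ Ka Kb cab; rewrite natrM => xab.
  have gab := gL (x a) (x b).
  have san : s a = `|g (x a)| by rewrite ga normrZ vn mulr1 ger0_norm.
  have sbn : s b = `|g (x b)| by rewrite gb normrZ vn mulr1 ger0_norm.
  have sab : `|s a - s b| <= L * `|x a - x b|.
    by rewrite san sbn; apply: le_trans gab; exact: ler_dist_dist.
  have sd : d <= s a by rewrite san gd.
  (* The angular distance is the displacement of [g] corrected by its radial part. Each of the two
     is at most L |x a - x b|, whence the factor 2. *)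
  have E : s a *: (v a - v b) = (g (x a) - g (x b)) - (s a - s b) *: v b.
    rewrite ga gb scalerBr scalerBl; apply/rowP => j; rewrite !mxE; ring.
  have h1 : s a * `|v a - v b| <= 2 * (L * `|x a - x b|).
    rewrite -{1}(ger0_norm sa) -normrZ E; apply: (le_trans (ler_normB _ _)).
    rewrite normrZ vn mulr1; lra.
  have h2 : d * `|v a - v b| <= 2 * (L * `|x a - x b|).
    by apply: le_trans h1; rewrite ler_wpM2r.
  have k00 : 0 < k%:R :> R by rewrite -(pmulr_lgt0 _ d0); lra.
  have kN : 0 < k%:R * N%:R :> R by rewrite mulr_gt0.
  have h3 : (k%:R * N%:R) * (d * `|v a - v b|) <= 4 * L.
    apply: (@le_trans _ _ (k%:R * N%:R * (2 * (L * `|x a - x b|)))).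
      by rewrite ler_pM2l.
    rewrite (_ : _ * _ = 2 * L * (k%:R * N%:R * `|x a - x b|)); last by ring.
    rewrite (_ : 4 * L = 2 * L * 2); last by ring.
    by rewrite ler_pM2l // mulr_gt0.
  rewrite -(@ltr_pM2l _ (k%:R * d)); last by rewrite mulr_gt0.
  rewrite mulr1; apply: le_lt_trans kP; apply: le_trans h3.
  by rewrite le_eqVlt; apply/orP; left; apply/eqP; ring.
have := leq_trans (leq_card _ inj) cT.
rewrite !card_prod !card_ord leqNgt => /negP; apply.
apply: (@leq_ltn_trans (C * (k.+1 * N) ^ 2)%N).
  by rewrite leq_mul2l; apply/orP; right; rewrite leq_exp2r // mulSn; lia.
rewrite expnMn mulnA (_ : (N * N * N = N * N ^ 2)%N); last by rewrite -mulnn mulnA.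
by rewrite ltn_pmul2r ?expn_gt0.
Qed.

End MissedRay.

(** * Simplices and their boundaries *)

Section Simplex.
Context {R : realType}.

Definition simplex n : set 'rV[R]_n.+1 :=
  [set t : 'rV[R]_n.+1 | (forall j, 0 <= t ord0 j) /\ \sum_j t ord0 j = 1].

Lemma simplexP n (t : std_simplex R n) : simplex (\val t).
Proof. exact: (set_valP t). Qed.

Definition simplex_mk n (x : 'rV[R]_n.+1) (h : simplex x) : std_simplex R n :=
  exist (fun t => t \in _) x (mem_set h).

Lemma simplex_val_continuous n :
  continuous (fun t : std_simplex R n => \val t : 'rV[R]_n.+1).
Proof. exact: initial_continuous. Qed.

Lemma cts_sum (T : topologicalType) (I : finType) (f : I -> T -> R) :
  (forall i, continuous (f i)) -> continuous (fun t => \sum_i f i t).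
Proof.
move=> cf; rewrite -[X in continuous X]/(fun t => _).
rewrite (_ : (fun t => _) = \sum_i (fun t => f i t)); last first.
  by apply/funext => t; rewrite fct_sumE.
elim/big_ind : _ => [|f1 f2 c1 c2|i _]; [exact: cts_cst|exact: cts_add|exact: cf].
Qed.

Let pos n (x : 'rV[R]_n.+1) j := Num.max 0 (x ord0 j).
Let tot n (x : 'rV[R]_n.+1) := \sum_j pos x j.

(** A retraction of the whole space onto the simplex: take positive parts, spread the deficit evenly
    if their total is below 1, rescale if it is above. It lets singular simplices be evaluated at
    arbitrary vectors. *)
Definition retract_fun n (x : 'rV[R]_n.+1) : 'rV[R]_n.+1 :=
  \row_j ((pos x j + Num.max 0 (1 - tot x) / n.+1%:R) / Num.max 1 (tot x)).

Fact retract_subproof n (x : 'rV[R]_n.+1) : simplex (retract_fun x).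
Proof.
have d0 : 0 < Num.max 1 (tot x) by rewrite lt_max ltr01.
have n0 : 0 < n.+1%:R :> R by rewrite ltr0n.
split=> [j|].
  rewrite mxE divr_ge0 ?(ltW d0) // addr_ge0 // ?divr_ge0 // ?le_max ?lexx //.
under eq_bigr do rewrite mxE.
rewrite -mulr_suml big_split /= sumr_const card_ord -/(tot x).
have E (a : R) : (a / n.+1%:R) *+ n.+1 = a by rewrite -[LHS]mulr_natr divfK ?gt_eqF.
rewrite E.
have -> : tot x + Num.max 0 (1 - tot x) = Num.max 1 (tot x).
  by case: (leP 1 (tot x)) => h; [rewrite (max_idPl _)|rewrite (max_idPr _)]; lra.
by rewrite divff // gt_eqF.
Qed.

Definition retract n (x : 'rV[R]_n.+1) : std_simplex R n := simplex_mk (retract_subproof x).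

Lemma retractK n (x : 'rV[R]_n.+1) : simplex x -> \val (retract x) = x.
Proof.
move=> [x0 x1].
have px j : pos x j = x ord0 j by rewrite /pos (max_idPr _).
have tx : tot x = 1 by rewrite /tot -[RHS]x1; apply: eq_bigr.
apply/rowP => j; rewrite /= mxE px tx subrr maxxx mul0r addr0 maxxx divr1.
by [].
Qed.

Lemma retract_continuous n : continuous (@retract n).
Proof.
have cp j : continuous (fun x : 'rV[R]_n.+1 => pos x j).
  by apply: cts_max; [exact: cts_cst|exact: cts_coord].
have ct : continuous (fun x : 'rV[R]_n.+1 => tot x) by exact: cts_sum.
apply: continuous_comp_initial; apply: cts_mx => i j.
rewrite (_ : (fun _ => _) = fun x : 'rV[R]_n.+1 =>
  (pos x j + Num.max 0 (1 - tot x) / n.+1%:R) * (Num.max 1 (tot x))^-1).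
  apply: cts_mul.
    apply: cts_add => //; apply: cts_mul; last exact: cts_cst.
    by apply: cts_max; [exact: cts_cst|apply: cts_sub => //; exact: cts_cst].
  move=> x; have h : Num.max 1 (tot x) != 0 by rewrite gt_eqF // lt_max ltr01.
  apply: (@cvgV _ _ (nbhs x) _ (fun x => Num.max 1 (tot x)) _ h).
  by apply: (@cts_max _ _ (fun=> 1)) => //; exact: cts_cst.
by apply/funext => x; rewrite /= mxE.
Qed.

Definition min_coord n (x : 'rV[R]_n.+1) : R := \big[Num.min/1]_j x ord0 j.

Lemma min_coord_continuous n : continuous (@min_coord n).
Proof.
rewrite /min_coord; elim: (index_enum _) => [|i r IH].
  rewrite (_ : (fun _ => _) = fun=> 1); first exact: cts_cst.
  by apply/funext => x; rewrite big_nil.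
rewrite (_ : (fun _ => _) = fun x : 'rV[R]_n.+1 =>
  Num.min (x ord0 i) (\big[Num.min/1]_(j <- r) x ord0 j)).
  by apply: cts_min => //; exact: cts_coord.
by apply/funext => x; rewrite big_cons.
Qed.

Lemma min_coord_le n (x : 'rV[R]_n.+1) j : min_coord x <= x ord0 j.
Proof. exact: bigmin_le. Qed.

Lemma min_coord_ge0 n (x : 'rV[R]_n.+1) : simplex x -> 0 <= min_coord x.
Proof. by move=> [x0 _]; apply: le_bigmin => // j _; exact: x0. Qed.

(** The starting value 1 of the fold cannot be the minimum: two coordinates would then be at least 1
    and exceed the total. *)
Lemma min_coord_attained n (x : 'rV[R]_n.+2) : simplex x -> exists j, min_coord x = x ord0 j.
Proof.
move=> [x0 x1].
have [] : min_coord x = 1 \/ exists j, min_coord x = x ord0 j; last by [].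
  rewrite /min_coord; elim/big_ind : _ => [|a b ha hb|i _]; [by left| |by right; exists i].
  by case: (leP a b).
move=> m1; exfalso.
have := min_coord_le x ord0; have := min_coord_le x (lift ord0 ord0); rewrite m1.
  move: x1; rewrite (bigD1_ord ord0) //= (bigD1_ord ord0) //=.
  have : 0 <= \sum_(i < n) x ord0 (lift ord0 (lift ord0 i)) by apply: sumr_ge0.
  lra.
Qed.

Lemma simplex_coord_le1 n (x : 'rV[R]_n.+1) j : simplex x -> x ord0 j <= 1.
Proof.
move=> [x0 x1]; rewrite -x1 (bigD1 j) //= lerDl; apply: sumr_ge0 => *; exact: x0.
Qed.

Definition bdry n : set 'rV[R]_n.+1 := simplex (n:=n) `&` [set x | min_coord x = 0].

Lemma closed_preim (T U : topologicalType) (f : T -> U) (D : set U) :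
  continuous f -> closed D -> closed [set x | D (f x)].
Proof. by move=> cf; apply: preimage_closed => x _; exact: cf. Qed.

Lemma simplex_closed n : closed (@simplex n).
Proof.
rewrite (_ : @simplex n = \bigcap_(j in [set: 'I_n.+1]) [set x | 0 <= x ord0 j] `&`
    [set x | \sum_j x ord0 j = 1]).
  apply: closedI.
    apply: closed_bigI => j _.
    exact: (closed_preim (@cts_coord _ _ _ ord0 j) (@closed_ge _ 0)).
  apply: (@closed_preim 'rV[R]_n.+1 R (fun x => \sum_j x ord0 j) [set y | y = 1]);
    last exact: closed_eq.
  by apply: cts_sum => j; exact: cts_coord.
apply/seteqP; split=> x [h1 h2]; split=> //; first by move=> j _; exact: h1.
by move=> j; exact: h1.
Qed.

Lemma bdry_compact n : compact (@bdry n).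
Proof.
apply: bounded_closed_compact.
  exists 1; split=> // M M1 x [hx _]; apply/rV_norm_leP; first by lra.
  move=> j; rewrite ger0_norm; last by have [h _] := hx.
  by apply: le_trans (ltW M1); exact: simplex_coord_le1.
apply: closedI; first exact: simplex_closed.
exact: (closed_preim (@min_coord_continuous n) (@closed_eq _ 0)).
Qed.

Lemma bdry_zero n (x : 'rV[R]_n.+2) : bdry x -> exists i, x ord0 i = 0.
Proof. by move=> [/min_coord_attained[i hi] h]; exists i; rewrite -hi. Qed.

Lemma zero_bdry n (x : 'rV[R]_n.+1) i : simplex x -> x ord0 i = 0 -> bdry x.
Proof.
move=> hx xi; split=> //=; apply/eqP.
by rewrite eq_le min_coord_ge0 // andbT -xi min_coord_le.
Qed.

(** A cell records a facet through the point and [m] of the other m + 1 coordinates, rounded down to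
    multiples of 1/n. The sum 1 controls the last coordinate up to m/n <= 2/n. The constant 4 bounds
    the number m + 2 of facets. *)
Lemma bdry_box_dim2 m : (m <= 2)%N -> box_dim2 (@bdry m.+1).
Proof.
move=> m2; exists 4 => n.
exists ('I_m.+2 * {ffun 'I_m -> 'I_n.+1})%type.
pose z (x : 'rV[R]_m.+2) : 'I_m.+2 := odflt ord0 [pick i | x ord0 i == 0].
pose l (i : 'I_m.+2) (j : 'I_m) : 'I_m.+2 := lift i (lift (ord0 : 'I_m.+1) j).
pose c (x : 'rV[R]_m.+2) (i : 'I_m.+2) : {ffun 'I_m -> 'I_n.+1} :=
  [ffun j => inord (Num.truncn (n%:R * x ord0 (l i j)))].
exists (fun x => (z x, c x (z x))); split.
  by rewrite card_prod card_ffun !card_ord leq_mul // leq_pexp2l.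
have zP x : bdry x -> x ord0 (z x) = 0.
  by move=> /bdry_zero[i xi]; rewrite /z; case: pickP => [j /eqP//|/(_ i)/eqP].
move=> x y hx hy [zxy]; have := zP _ hx; have := zP _ hy; rewrite -zxy.
move: (z x) => i yi xi cxy.
have tr (w : 'rV[R]_m.+2) k : bdry w -> (Num.truncn (n%:R * w ord0 k) <= n)%N.
  move=> [hw _]; rewrite truncn_le_nat.
  apply: (@le_lt_trans _ _ n%:R); last by rewrite ltr_nat.
  by rewrite -[leRHS]mulr1 ler_wpM2l // simplex_coord_le1.
have hj j : n%:R * `|x ord0 (l i j) - y ord0 (l i j)| <= 1.
  move: cxy => /ffunP/(_ j); rewrite !ffunE => /(congr1 val) /=.
  rewrite !inordK ?ltnS ?tr //.
  have nx : 0 <= n%:R * x ord0 (l i j) by rewrite mulr_ge0 // hx.1.1.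
  have ny : 0 <= n%:R * y ord0 (l i j) by rewrite mulr_ge0 // hy.1.1.
  have /andP[] := truncn_itv nx; have /andP[] := truncn_itv ny => + + + + E.
  rewrite E -natr1 => ? ? ? ?.
  rewrite -{1}(@ger0_norm R n%:R) // -normrM mulrBr ler_norml; lra.
have hl : x ord0 (lift i (ord0 : 'I_m.+1)) - y ord0 (lift i (ord0 : 'I_m.+1)) =
   \sum_j (y ord0 (l i j) - x ord0 (l i j)).
  have := hx.1.2; have := hy.1.2; rewrite (bigD1_ord i) //= yi (bigD1_ord ord0) //=.
  rewrite (bigD1_ord i) //= xi (bigD1_ord ord0) //= sumrB /l; lra.
have n0 : 0 <= n%:R :> R by [].
have hl2 : n%:R * `|x ord0 (lift i (ord0 : 'I_m.+1)) - y ord0 (lift i (ord0 : 'I_m.+1))| <= 2.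
  rewrite hl; apply: (@le_trans _ _ (\sum_(j < m) 1)).
    apply: (@le_trans _ _ (n%:R * \sum_(j < m) `|y ord0 (l i j)
                                            - x ord0 (l i j)|)).
      by rewrite ler_wpM2l // ler_norm_sum.
    by rewrite mulr_sumr; apply: ler_sum => j _; rewrite distrC.
  by rewrite sumr_const card_ord ler_nat.
have hk k : n%:R * `|x ord0 k - y ord0 k| <= 2.
  case: (unliftP i k) => [k' ->|->]; last by rewrite xi yi subrr normr0 mulr0.
  case: (unliftP ord0 k') => [j ->|-> //].
  by apply: (le_trans (hj j)); lra.
case: n n0 hk {c tr hj hl2 cxy} => [|n] n0 hk; first by rewrite mul0r.
rewrite mulrC -ler_pdivlMr ?ltr0n //.
apply/rV_norm_leP; first by rewrite divr_ge0.
by move=> k; rewrite !mxE ler_pdivlMr ?ltr0n // mulrC.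
Qed.

End Simplex.

(** * Nowhere zero extension from the boundary of a simplex *)

Section BoundaryExtension.
Context {R : realType}.

(* Writing mu for the barycentric depth and p for the projection from the
   barycentre to the boundary, F is deformed for mu <= 1/2 to a Lipschitz map g
   which misses the ray through v, then g is contracted to - v for mu >= 1/2. *)
Lemma boundary_extension m (F : 'rV[R]_m.+2 -> 'rV[R]_4) : (m <= 2)%N ->
  {within bdry (n:=m.+1), continuous F} ->
  (forall x, bdry x -> 1 / 2 <= `|F x| <= 1) ->
  exists G : std_simplex R m.+1 -> 'rV[R]_4, [/\ continuous G,
    forall u, G u != 0 & forall u, bdry (\val u) -> G u = F (\val u)].
Proof.
move=> m2 cF F1.
(* The error 1/8 leaves |g| >= 3/8 on the boundary; for mu <= 1/2 it opposes a term of norm at most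
   1/16 to one of norm at least 1/4. *)
have e0 : 0 < 1 / 8 :> R by lra.
have [g [L [L0 gL Fg]]] := lipschitz_approx_rV (@bdry_compact R m.+1) cF e0.
have cg : continuous g by exact: lipschitz_continuous gL.
have gd x : bdry x -> 3 / 8 <= `|g x| <= 2.
  move=> hx; have := Fg _ hx; have /andP[] := F1 _ hx.
  have := ler_normD (F x - g x) (g x); rewrite subrK.
  have := ler_normB (F x) (F x - g x); rewrite opprB addrCA subrr addr0.
  lra.
have [v v0 vg] : exists2 v : 'rV[R]_4, v != 0 &
    forall x s, bdry x -> 0 <= s -> g x != s *: v.
  apply: (@missed_ray _ _ _ g L (3 / 8)) => //; first exact: bdry_box_dim2.
  by move=> x /gd/andP[].
pose c (u : std_simplex R m.+1) := min_coord (\val u).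
pose mu u := m.+2%:R * c u.
pose p u : 'rV[R]_m.+2 := (1 - mu u)^-1 *: (\val u - const_mx (c u)).
have cc : continuous c.
  exact: (cts_comp (@min_coord_continuous _ _) (@simplex_val_continuous _ _)).
have cmu : continuous mu by apply: cts_mul => //; exact: cts_cst.
have mu0 u : 0 <= mu u by rewrite mulr_ge0 // min_coord_ge0 //; exact: simplexP.
have mu1 u : mu u <= 1.
  have [_ <-] := simplexP u; rewrite /mu mulr_natl -[m.+2 in X in X <= _]card_ord -sumr_const.
  by apply: ler_sum => j _; exact: min_coord_le.
have bp u : mu u < 1 -> bdry (p u).
  move=> u1; have h : 0 < 1 - mu u by lra.
  have [u0 us] := simplexP u.
  have [j cj] := min_coord_attained (simplexP u).
  apply: (@zero_bdry _ _ _ j); last first.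
    by rewrite !mxE -cj subrr mulr0.
  split=> [k|].
    by rewrite !mxE mulr_ge0 ?invr_ge0 ?(ltW h) // subr_ge0 min_coord_le.
  under eq_bigr do rewrite !mxE.
  rewrite -mulr_sumr sumrB us sumr_const card_ord -[c u *+ _]mulr_natl mulVf //.
  by rewrite gt_eqF.
have cp u : mu u < 1 -> p @ u --> p u.
  move=> u1; have h : 1 - mu u != 0 by rewrite gt_eqF // subr_gt0.
  apply: at_scale.
    apply: (@at_inv _ _ _ (fun u => 1 - mu u)) => //.
    by apply: (@cts_sub _ _ (fun=> 1)) => //; exact: cts_cst.
  apply: at_sub; first exact: simplex_val_continuous.
  have h2 : continuous (fun u => const_mx (c u) : 'rV[R]_m.+2).
    apply: cts_mx => i j; rewrite (_ : (fun _ => _) = c) //.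
    by apply/funext => w; rewrite mxE.
  exact: h2.
have cgp u : mu u < 1 -> (fun u => g (p u)) @ u --> g (p u).
  move=> u1; have k := cvg_comp _ _ (cp u u1) (cg (p u)); exact: k.
have cFp u : mu u < 1 -> (fun u => F (p u)) @ u --> F (p u).
  (* [F] is continuous only within the boundary; since [p] maps a neighbourhood of [u] into the
     boundary, the limit can be taken there. *)
  move=> u1; move/subspace_continuousP: cF => /(_ _ (bp _ u1)) cFu.
  have nb : \forall w \near u, mu w < 1 by exact: (cmu u _ (lt_nbhsl u1)).
  have pw : p @ u --> within (@bdry R m.+1) (nbhs (p u)).
    move=> A; rewrite /within /= => /(cp _ u1) /= nA.
    apply: (@filterS2 _ (nbhs u) _ _ _ _ _ nA nb) => w h w1.
    by apply: h; exact: bp.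
  have k := cvg_comp _ _ pw cFu; exact: k.
(* The value is F at mu = 0, g (p u) / 2 at mu = 1/2 and - v at mu = 1. The factor 1 - mu damps
   [g (p u)] at the barycentre, where the projection has no limit. *)
pose G u := Num.max 0 (1 - 2 * mu u) *: (F (p u) - g (p u)) +
  (1 - mu u) *: g (p u) + Num.max 0 (2 * mu u - 1) *: (- v).
have c2mu : continuous (fun u => 2 * mu u) by apply: cts_mul => //; exact: cts_cst.
have cD : continuous (fun u => Num.max 0 (2 * mu u - 1) *: (- v)).
  move=> u; apply: (@at_scale _ _ _ _ _ (fun=> - v)); last exact: cts_cst.
  apply: (@cts_max_at _ _ (fun u => 2 * mu u - 1)).
  by apply: (@cts_sub _ _ (fun u => 2 * mu u) (fun=> 1)) => //; exact: cts_cst.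
exists G; split.
- move=> u; have [u1|u1] := ltP (mu u) 1.
    apply: at_add; last exact: cD.
    apply: at_add.
      apply: at_scale; last by apply: at_sub; [exact: cFp|exact: cgp].
      apply: (@cts_max_at _ _ (fun u => 1 - 2 * mu u)).
      by apply: (@cts_sub _ _ (fun=> 1) (fun u => 2 * mu u)) => //; exact: cts_cst.
    apply: at_scale; last exact: cgp.
    by apply: (@cts_sub _ _ (fun=> 1) mu) => //; exact: cts_cst.
  have {}u1 : mu u = 1 by apply/eqP; rewrite eq_le mu1.
  apply: at_add; last exact: cD.
  rewrite u1 subrr scale0r addr0 (max_idPl _); last by lra.
  rewrite scale0r.
  (* Near the barycentre mu exceeds 1/2, which kills the first summand, and |g| <= 2 on the boundary
     bounds the second by 2 (1 - mu). *)
  apply/(@cvgrPdist_lt _ _ _ (nbhs u)) => e e1.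
  have nu : \forall w \near u, `|mu u - mu w| < Num.min (1/2) (e / 2).
    have : 0 < Num.min (1/2) (e / 2) by rewrite lt_min; apply/andP; split; lra.
    by move: (cmu u) => /cvgrPdist_lt; apply.
  near=> w; have : `|mu u - mu w| < Num.min (1/2) (e / 2) by near: w.
  rewrite lt_min u1 => /andP[]; rewrite !ltr_norml => /andP[_ h1] /andP[_ h2].
  rewrite (max_idPl _); last by lra.
  rewrite scale0r !add0r normrN normrZ ger0_norm; last by have := mu1 w; lra.
  have [w1|w1] := ltP (mu w) 1; last first.
    have -> : mu w = 1 by apply/eqP; rewrite eq_le mu1.
    by rewrite subrr mul0r.
  have /andP[_ h3] := gd _ (bp _ w1).
  apply: (@le_lt_trans _ _ ((1 - mu w) * 2)); last by lra.
  by rewrite ler_wpM2l //; lra.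
- move=> u; rewrite /G; have [u1|u1] := leP (mu u) (1 / 2).
    rewrite (max_idPr _); last by lra.
    rewrite (max_idPl _); last by lra.
    rewrite scale0r addr0.
    have bpu : bdry (p u) by apply: bp; lra.
    have -> : (1 - 2 * mu u) *: (F (p u) - g (p u)) + (1 - mu u) *: g (p u) =
        (1 - mu u) *: F (p u) - mu u *: (F (p u) - g (p u)).
      by apply/rowP => j; rewrite !mxE; ring.
    rewrite subr_eq0; apply/eqP => E.
    have : (1 - mu u) * `|F (p u)| = mu u * `|F (p u) - g (p u)|.
      rewrite -{1}(@ger0_norm _ (1 - mu u)); last by lra.
      by rewrite -{2}(ger0_norm (mu0 u)) -!normrZ E.
    have /andP[h1 _] := F1 _ bpu; have h2 := Fg _ bpu.
    have : (1 / 2) * (1 / 2) <= (1 - mu u) * `|F (p u)| by apply: ler_pM; lra.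
    have : mu u * `|F (p u) - g (p u)| <= (1 / 2) * (1 / 8) by apply: ler_pM.
    lra.
  rewrite (max_idPl _); last by lra.
  rewrite (max_idPr _); last by lra.
  (* For mu > 1/2 a zero of [G] would put [g (p u)] on the missed ray; at mu = 1 only - v
     remains. *)
  rewrite scale0r add0r scalerN subr_eq0.
  have [w1|w1] := ltP (mu u) 1; last first.
    have -> : mu u = 1 by apply/eqP; rewrite eq_le mu1.
    rewrite subrr scale0r eq_sym scaler_eq0 negb_or v0 andbT; apply/eqP; lra.
  have h : 1 - mu u != 0 by apply/eqP; lra.
  apply/negP => /eqP /(congr1 (fun x => (1 - mu u)^-1 *: x)).
  rewrite !scalerA mulVf // scale1r => /eqP; apply/negP; apply: vg; first exact: bp.
  by rewrite mulr_ge0 ?invr_ge0; lra.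
- move=> u [_ cu]; have {}cu : c u = 0 by [].
  have mu00 : mu u = 0 by rewrite /mu cu mulr0.
  have pu : p u = \val u.
    by rewrite /p mu00 cu subr0 invr1 scale1r; apply/rowP => j; rewrite !mxE subr0.
  rewrite /G mu00 pu mulr0 subr0 sub0r (max_idPr _); last by lra.
  rewrite (max_idPl _); last by lra.
  by rewrite scale0r addr0 !scale1r subrK.
Unshelve. all: by end_near. Qed.

End BoundaryExtension.

(** * The second cohomology of the 3-sphere *)

Section SphereFilling.
Context {R : realType}.

Definition s3vec (z : S3 R) : 'rV[R]_4 := \row_i s3c i z.

Lemma s3vec_continuous : continuous s3vec.
Proof.
apply: cts_mx => i j; rewrite (_ : (fun _ => _) = s3c j); first exact: s3c_continuous.
by apply/funext => z; rewrite mxE.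
Qed.

(** Row vectors carry the maximum norm, and of four squares with sum 1 one is at least 1/4. *)
Lemma s3vec_norm z : 1 / 2 <= `|s3vec z| <= 1.
Proof.
have z1 := s3c_sq z; apply/andP; split; last first.
  apply/rV_norm_leP => // j; rewrite mxE ler_norml.
  move: j; apply: ord4_ind; nra.
rewrite leNgt; apply/negP => h.
have hj j : - (1 / 2) < s3c j z < 1 / 2.
  rewrite -ltr_norml; apply: le_lt_trans h.
  have /rV_norm_leP : `|s3vec z| <= `|s3vec z| by [].
  by move=> /(_ (normr_ge0 _) j); rewrite mxE.
have sq j : s3c j z ^+ 2 < 1 / 4 by have := hj j; nra.
have := (sq k0, sq k1, sq k2, sq k3) => -[[[]]]; lra.
Qed.

(** The Euclidean norm squared, as opposed to the maximum norm of ['rV[R]_4]. *)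
Definition normsq (x : 'rV[R]_4) : R :=
  x ord0 k0 ^+ 2 + x ord0 k1 ^+ 2 + x ord0 k2 ^+ 2 + x ord0 k3 ^+ 2.

Lemma normsq_gt0 (x : 'rV[R]_4) : x != 0 -> 0 < normsq x.
Proof.
move=> x0; rewrite lt_neqAle eq_sym /normsq !addr_ge0 ?sqr_ge0 // andbT.
apply: contra x0; rewrite !paddr_eq0 ?addr_ge0 ?sqr_ge0 // !sqrf_eq0.
move=> /andP[/andP[/andP[/eqP h0 /eqP h1] /eqP h2] /eqP h3].
by apply/eqP/rowP; apply: ord4_ind; rewrite mxE.
Qed.

Lemma normsq_s3vec z : normsq (s3vec z) = 1.
Proof. by rewrite /normsq !mxE s3c_sq. Qed.

Fact normalize_subproof (x : 'rV[R]_4) : x != 0 ->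
  (x ord0 k0 / Num.sqrt (normsq x)) ^+ 2 + (x ord0 k1 / Num.sqrt (normsq x)) ^+ 2 +
  (x ord0 k2 / Num.sqrt (normsq x)) ^+ 2 + (x ord0 k3 / Num.sqrt (normsq x)) ^+ 2 = 1.
Proof.
move=> /normsq_gt0 x0; rewrite !expr_div_n sqr_sqrtr ?ltW // -!mulrDl.
by rewrite divff // gt_eqF.
Qed.

Definition normalize (x : 'rV[R]_4) (h : x != 0) : S3 R := S3_mk (normalize_subproof h).

Lemma normalize_coord (x : 'rV[R]_4) (h : x != 0) i :
  s3c i (normalize h) = x ord0 i / Num.sqrt (normsq x).
Proof. by move: i; apply: ord4_ind. Qed.

Lemma normalize_s3vec z (h : s3vec z != 0) : normalize h = z.
Proof.
by apply: S3_eq => i; rewrite normalize_coord normsq_s3vec sqrtr1 divr1 mxE.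
Qed.

Lemma normalize_continuous (T : topologicalType) (G : T -> 'rV[R]_4) (h : forall t, G t != 0) :
  continuous G -> continuous (fun t => normalize (h t)).
Proof.
move=> cG; have cGi i : continuous (fun t => G t ord0 i).
  exact: (cts_comp (@cts_coord _ _ _ ord0 i) cG).
have cn : continuous (fun t => normsq (G t)).
  by apply: cts_add; [apply: cts_add; [apply: cts_add|]|]; exact: cts_sq.
apply: S3_continuous => i.
rewrite (_ : (fun _ => _) = fun t => G t ord0 i * (Num.sqrt (normsq (G t)))^-1).
  apply: cts_mul => // t; apply: at_inv.
    by rewrite sqrtr_eq0 -ltNge normsq_gt0.
  exact: (cts_comp (@sqrt_continuous R) cn).
by apply/funext => t; rewrite normalize_coord.
Qed.

Definition drop_coord n (i : 'I_n.+2) (x : 'rV[R]_n.+2) : 'rV[R]_n.+1 :=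
  \row_k x ord0 (lift i k).

Lemma simplex_drop n (i : 'I_n.+2) (x : 'rV[R]_n.+2) :
  simplex x -> x ord0 i = 0 -> simplex (drop_coord i x).
Proof.
move=> [x0 x1] xi; split=> [k|]; first by rewrite mxE.
by move: x1; rewrite (bigD1_ord i) //= xi add0r => <-; apply: eq_bigr => k _; rewrite mxE.
Qed.

Lemma val_coface n (i : 'I_n.+2) (t : std_simplex R n) :
  (\val (coface i t) ord0 i = 0) * (forall k, \val (coface i t) ord0 (lift i k) = \val t ord0 k).
Proof. by split=> [|k]; rewrite mxE ?unlift_none ?liftK. Qed.

Lemma cofaceP n (i : 'I_n.+2) (t : std_simplex R n) (x : std_simplex R n.+1) :
  \val x ord0 i = 0 -> (forall k, \val x ord0 (lift i k) = \val t ord0 k) ->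
  coface i t = x.
Proof.
move=> xi xk; apply/val_inj/rowP => j.
by case: (unliftP i j) => [k|] ->; rewrite val_coface.
Qed.

Lemma coface_drop n (i : 'I_n.+2) (x : std_simplex R n.+1) : \val x ord0 i = 0 ->
  coface i (retract (drop_coord i (\val x))) = x.
Proof.
move=> xi; apply: cofaceP => // k.
by rewrite retractK ?mxE //; apply: simplex_drop => //; exact: simplexP.
Qed.

(** Faces that agree where they meet glue to a map from the boundary to S^3 inside R^4; its nowhere
    zero extension is normalized back to the sphere. *)
Lemma sphere_fill m (s : 'I_m.+2 -> sing R (S3 R) m) : (m <= 2)%N ->
  (forall i j t t', coface i t = coface j t' -> s i t = s j t') ->
  exists f : sing R (S3 R) m.+1, forall i, sface i f = s i.
Proof.
move=> m2 cs.
pose pc i (x : 'rV[R]_m.+2) := s3vec (s i (retract (drop_coord i x))).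
have cpc i : continuous (pc i).
  apply: cts_comp; first exact: s3vec_continuous.
  apply: (cts_comp (@cts_fun _ _ (s i))).
  apply: cts_comp; first exact: retract_continuous.
  apply: cts_mx => a k; rewrite (_ : (fun _ => _) = fun x : 'rV[R]_m.+2 => x ord0 (lift i k)).
    exact: cts_coord.
  by apply/funext => x; rewrite mxE.
pose F (x : 'rV[R]_m.+2) : 'rV[R]_4 := if [pick i | x ord0 i == 0] is Some i then pc i x else 0.
have FE x i : simplex x -> x ord0 i = 0 -> F x = pc i x.
  move=> hx xi; rewrite /F; case: pickP => [j /eqP xj|/(_ i)/eqP//].
  rewrite /pc; congr s3vec; apply: cs.
  by rewrite (@coface_drop _ j (simplex_mk hx)) // (@coface_drop _ i (simplex_mk hx)).
have cF : {within bdry (n:=m.+1), continuous F}.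
  apply/subspace_continuousP => x hx A nA.
  (* A coordinate that is nonzero at [x] stays nonzero nearby, so only the finitely many facets
     through [x] matter, and on each of them [pc i] is continuous. *)
  have : \forall y \near (x : 'rV[R]_m.+2), forall i : 'I_m.+2,
      (y : 'rV[R]_m.+2) ord0 i = 0 -> simplex y -> A (pc i y).
    apply: (@filter_forall 'rV[R]_m.+2 'I_m.+2 
      (fun i y => y ord0 i = 0 -> simplex y -> A (pc i y)) (nbhs x)) => i.
    have [xi|xi] := eqVneq (x ord0 i) 0.
      have : nbhs (pc i x) A by rewrite -(FE _ i hx.1 xi).
      by move=> /(cpc i x) h; apply: (@filterS _ (nbhs x) _ _ _ _ h) => y hy _ _.
    have h : \forall y \near (x : 'rV[R]_m.+2), (y : 'rV[R]_m.+2) ord0 i != 0.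
      exact: (@cts_coord R _ _ ord0 i x _ (open_nbhs_nbhs (conj (@open_neq _ 0) xi))).
    by apply: (@filterS _ (nbhs x) _ _ _ _ h) => y /eqP hy.
  move=> hA; rewrite /within /=; apply: (@filterS _ (nbhs x) _ _ _ _ hA) => y hy by_.
  by have [i yi] := bdry_zero by_; change (A (F y)); rewrite (FE _ i by_.1 yi); exact: hy by_.1.
have [|G [cG G0 GF]] := boundary_extension m2 cF.
  move=> x hx; have [i xi] := bdry_zero hx.
  by rewrite (FE _ i hx.1 xi) s3vec_norm.
exists (mkcts (normalize_continuous (h:=G0) cG)) => i.
apply/continuousEP => t /=.
have h : bdry (\val (coface i t)).
  by apply: (@zero_bdry _ _ _ i); [exact: simplexP|rewrite val_coface].
have E : G (coface i t) = s3vec (s i t).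
  rewrite GF // (FE _ i h.1) ?val_coface //; congr (s3vec (s i _)).
  by apply/val_inj; rewrite retractK; [apply/rowP => k; rewrite mxE val_coface|
    apply: simplex_drop h.1 _; rewrite val_coface].
change (normalize (G0 (coface i t)) = s i t).
move: (G0 (coface i t)); rewrite E => h0; exact: normalize_s3vec.
Qed.

End SphereFilling.

(** * Simplicial identities and cones in the sphere *)

Section SimplicialIdentities.
Context {R : realType}.

(** The cosimplicial identity on vertices. The primed indices are i and j + 1 in the larger ordinal,
    specified by their values so that no casts occur. *)
Lemma lift_lift_swap n (i' j' : 'I_n.+3) (i j : 'I_n.+2) (k : 'I_n.+1) :
  val i' = val i -> val j' = (val j).+1 -> (i <= j)%N ->
  lift i' (lift j k) = lift j' (lift i k).
Proof.
by move=> ei ej ij; apply: val_inj; rewrite /= /bump -/(val i') -/(val j') ei ej /=; lia.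
Qed.

Lemma lift_lower n (i' j' : 'I_n.+2) (i : 'I_n.+1) (j : 'I_n.+1) :
  val i' = val i -> val j' = (val j).+1 -> (i <= j)%N ->
  lift j' i = i' /\ lift i' j = j'.
Proof.
by move=> ei ej ij; split; apply: val_inj;
  rewrite /= /bump -/(val i') -/(val j') ei ej /=; lia.
Qed.

Lemma coface_swap n (i' j' : 'I_n.+3) (i j : 'I_n.+2) (t : std_simplex R n) :
  val i' = val i -> val j' = (val j).+1 -> (i <= j)%N ->
  coface j' (coface i t) = coface i' (coface j t).
Proof.
move=> ei ej ij; have [li lj] := lift_lower ei ej ij.
apply/esym/cofaceP => [|k]; first by rewrite -li val_coface val_coface.
case: (unliftP j k) => [l|] ->; first by rewrite (lift_lift_swap _ ei ej ij) !val_coface.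
by rewrite lj !val_coface.
Qed.

Lemma coface_meet n (i' j' : 'I_n.+3) (i j : 'I_n.+2) (t t' : std_simplex R n.+1) :
  val i' = val i -> val j' = (val j).+1 -> (i <= j)%N ->
  coface i' t = coface j' t' ->
  exists w : std_simplex R n, t = coface j w /\ t' = coface i w.
Proof.
move=> ei ej ij E; have [li lj] := lift_lower ei ej ij.
have tE k : \val t ord0 k = \val (coface i' t) ord0 (lift i' k) by rewrite val_coface.
have t'E k : \val t' ord0 k = \val (coface i' t) ord0 (lift j' k) by rewrite E val_coface.
have tj : \val t ord0 j = 0 by rewrite tE lj E val_coface.
exists (retract (drop_coord j (\val t))); split; first by rewrite coface_drop.
apply/esym/cofaceP => [|k]; first by rewrite t'E li val_coface.
rewrite retractK; last by apply: simplex_drop => //; exact: simplexP.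
by rewrite t'E -(lift_lift_swap _ ei ej ij) -tE mxE.
Qed.

Lemma coface_inj n (i : 'I_n.+2) : injective (@coface R n i).
Proof.
move=> t t' E; apply/val_inj/rowP => k.
by rewrite -(val_coface i t).2 -(val_coface i t').2 E.
Qed.

Lemma sface_swap (X : topologicalType) n (i' j' : 'I_n.+3) (i j : 'I_n.+2)
    (s : sing R X n.+2) :
  val i' = val i -> val j' = (val j).+1 -> (i <= j)%N ->
  sface i (sface j' s) = sface j (sface i' s).
Proof.
move=> ei ej ij; apply/continuousEP => t /=.
by rewrite (coface_swap _ ei ej ij).
Qed.

(** Two facets meet exactly in their common face ([coface_meet]), so the simplicial identities
    amount to the pointwise agreement that [sphere_fill] asks for. *)
Lemma sphere_fill_faces n (s : 'I_n.+3 -> sing R (S3 R) n.+1) : (n.+1 <= 2)%N ->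
  (forall (i' j' : 'I_n.+3) (i j : 'I_n.+2), val i' = val i -> val j' = (val j).+1 ->
     (i <= j)%N -> sface j (s i') = sface i (s j')) ->
  exists f : sing R (S3 R) n.+2, forall i, sface i f = s i.
Proof.
move=> n2 h; apply: sphere_fill => // i j t t'.
have key (i' j' : 'I_n.+3) u u' : (i' < j')%N -> coface i' u = coface j' u' ->
    s i' u = s j' u'.
  move=> ij E.
  have hi : (i' < n.+2)%N by have := ltn_ord j'; lia.
  have hj : (j'.-1 < n.+2)%N by have := ltn_ord j'; lia.
  have ej : val j' = (val (Ordinal hj)).+1 by rewrite /=; lia.
  have ij1 : (Ordinal hi <= Ordinal hj)%N by rewrite /=; lia.
  have ei : val i' = val (Ordinal hi) by [].
  have [w [-> ->]] := coface_meet ei ej ij1 E.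
  by have /continuousEP/(_ w) := h _ _ _ _ ei ej ij1.
case: (ltngtP i j) => [ij|ij|/val_inj <-]; first exact: key.
  by move=> /esym/(key _ _ _ _ ij).
by move=> /coface_inj ->.
Qed.

(** Raises a cone operator by one dimension: the base [s] and the cones [P] over its faces bound the
    cone over [s]. One hypothesis fits the sides to the base, the other fits the sides to each
    other. *)
Lemma cone_fill n (P : sing R (S3 R) n -> sing R (S3 R) n.+1) (s : sing R (S3 R) n.+1) :
  (n.+1 <= 2)%N -> (forall t, sface ord0 (P t) = t) ->
  (forall i j : 'I_n.+1, (i <= j)%N ->
    sface (lift ord0 j) (P (sface (widen_ord (leqnSn _) i) s)) =
    sface (lift ord0 i) (P (sface (lift ord0 j) s))) ->
  exists f : sing R (S3 R) n.+2, sface ord0 f = s /\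
    forall k, sface (lift ord0 k) f = P (sface k s).
Proof.
move=> n2 P0 PP.
pose F (k : 'I_n.+3) := if unlift ord0 k is Some k' then P (sface k' s) else s.
have F0 : F ord0 = s by rewrite /F unlift_none.
have FS k : F (lift ord0 k) = P (sface k s) by rewrite /F liftK.
have [|f hf] := @sphere_fill_faces n F n2; last first.
  by exists f; split=> [|k]; rewrite hf.
move=> i' j' i j ei ej ij.
have -> : j' = lift ord0 j by apply: val_inj; rewrite ej.
rewrite FS; case: (unliftP ord0 i) ei ij => [i1|] -> ei ij.
  have -> : i' = lift ord0 (widen_ord (leqnSn _) i1) by apply: val_inj; rewrite ei.
  case: (unliftP ord0 j) ij {ej} => [j1|] ->; rewrite /= /bump /= ?add1n ?add0n // => ij.
  by rewrite FS PP.
have -> : i' = ord0 by apply: val_inj; rewrite ei.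
by rewrite F0 P0.
Qed.

Lemma point_joined (x : sing R (S3 R) 0) :
  exists p : sing R (S3 R) 1, sface ord0 p = x /\
    sface (lift ord0 ord0) p = mkcts (@cts_cst (std_simplex R 0) _ (@S3_pt R)).
Proof.
pose F (k : 'I_2) : sing R (S3 R) 0 :=
  if unlift ord0 k is Some k' then mkcts (@cts_cst (std_simplex R 0) _ (@S3_pt R)) else x.
have [//|i j t t' E|f hf] := @sphere_fill R 0 F; last first.
  by exists f; rewrite !hf /F unlift_none liftK.
(* The two end points of an interval are disjoint: a common point would have both barycentric
   coordinates equal to 0. *)
suff ij : i = j by move: E; rewrite ij => /coface_inj ->.
apply: contrapT => nij; have := (simplexP (coface i t)).2.
have hi : \val (coface i t) ord0 i = 0 by rewrite val_coface.
have hj : \val (coface i t) ord0 j = 0 by rewrite E val_coface.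
have h k : \val (coface i t) ord0 k = 0.
  have [->|->//] : k = i \/ k = j; last by [].
  case: i j k nij {E hi hj} => [i hi] [j hj] [k hk] nij.
  have : i <> j by move=> ij; apply: nij; apply: val_inj.
  by move=> ij'; case: (eqVneq k i) => ki; [left|right]; apply: val_inj => //=; lia.
rewrite big1 // => /eqP; by rewrite eq_sym oner_eq0.
Qed.

(* A cone operator compatible with faces exists in dimension at most 2
   because S^3 is 2-connected; it contracts the cochain complex. *)
Lemma S3_cocycle_coboundary (c : cochain R (S3 R) 2) : is_cocycle c -> is_coboundary c.
Proof.
move=> cc.
have [P0 hP0] := choice point_joined.
have h1 (t : sing R (S3 R) 1) := @cone_fill 0 P0 t isT (fun x => (hP0 x).1).
have {h1} /choice[P1 hP1] t : exists f : sing R (S3 R) 2, sface ord0 f = t /\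
    forall k, sface (lift ord0 k) f = P0 (sface k t).
  by apply: h1 => i j _; rewrite !ord1 !(hP0 _).2.
have h2 (t : sing R (S3 R) 2) := @cone_fill 1 P1 t isT (fun x => (hP1 x).1).
have {h2} /choice[P2 hP2] t : exists f : sing R (S3 R) 3, sface ord0 f = t /\
    forall k, sface (lift ord0 k) f = P1 (sface k t).
  apply: h2 => i j ij; rewrite !(hP1 _).2; congr P0.
  by apply/esym/sface_swap.
(* The boundary of [P2 s] is s minus the signed sum of [P1] over the faces of s; evaluating the
   cocycle [c] on it gives 0. *)
exists (fun t => c (P1 t)) => s.
have := cc (P2 s); rewrite /coboundary big_ord_recl (hP2 s).1 expr0 mul1r.
move=> /eqP; rewrite addr_eq0 => /eqP ->; rewrite -sumrN.
apply: eq_bigr => i _; rewrite (hP2 s).2 -mulNr; congr (_ * _).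
by rewrite /= /bump /= add1n exprS mulN1r opprK.
Qed.

End SimplicialIdentities.

(** * Lifting along a parallel transport *)

Section Lifting.
Context {R : realType}.
Local Notation I := (unit_itv R).

Lemma unit_itv_compact : compact [set: I].
Proof.
rewrite (_ : [set: I] = clamp @` `[0, 1]%classic).
  apply: continuous_compact; last exact: segment_compact.
  by apply: continuous_subspaceT; exact: clamp_continuous.
apply/seteqP; split=> // t _; exists (itv_val t); last exact: itv_valK.
by rewrite /= in_itv /= itv_val_ge0 itv_val_le1.
Qed.

Lemma nbhs_unit_itv (s : I) (V : set I) : nbhs s V ->
  exists2 r : R, 0 < r & forall t, `|itv_val s - itv_val t| < r -> V t.
Proof.
move=> sV; have : nbhs (itv_val s) (clamp @^-1` V).
  by apply: clamp_continuous; rewrite itv_valK.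
move=> /nbhs_normP[r r0 hr]; exists r => // t st.
by rewrite -(itv_valK t); exact: hr.
Qed.

Section Subdivision.
Context {Y B : topologicalType} (cY : compact [set: Y]).
Context (Phi : Y * I -> B) (cPhi : continuous Phi).
Context (N : B -> B -> Prop) (N_refl : forall b, N b b).
Context (N_open : forall (T : topologicalType) (f g : T -> B) (t : T),
  continuous f -> continuous g -> N (f t) (g t) -> \forall u \near t, N (f u) (g u)).

(** A Lebesgue number argument on the compact space Y * I. [N_open] is openness of [N], a
    neighbourhood of the diagonal, phrased through pairs of maps, the form in which it is
    applied. *)
Lemma uniform_subdivision : exists n : nat, forall y s t,
  `|itv_val s - itv_val t| <= n.+1%:R^-1 -> N (Phi (y, s)) (Phi (y, t)).
Proof.
have cYI : compact [set: Y * I].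
  by rewrite -setXTT; exact: compact_setX unit_itv_compact.
move/compact_near_coveringP : cYI => cov.
have : \forall n \near \oo, [set: Y * I] `<=` [set ys | forall t,
    `|itv_val ys.2 - itv_val t| <= n.+1%:R^-1 -> N (Phi ys) (Phi (ys.1, t))].
  apply: cov => -[y0 s0] _ /=.
  have c1 : continuous (fun u : (Y * I) * I => Phi u.1).
    exact: (cts_comp cPhi (@cts_fst _ _)).
  have c2 : continuous (fun u : (Y * I) * I => Phi (u.1.1, u.2)).
    apply: (cts_comp cPhi); apply: cts_pair; last exact: cts_snd.
    exact: (cts_comp (@cts_fst _ _) (@cts_fst _ _)).
  have [[W V] /= [hW hV] WV] := N_open (t := ((y0, s0), s0)) c1 c2 (N_refl _).
  have [r r0 rV] := nbhs_unit_itv hV.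
  have r2 : 0 < r / 2 by lra.
  exists (W `&` [set ys | `|itv_val s0 - itv_val ys.2| < r / 2],
      [set n : nat | n.+1%:R^-1 < r / 2]).
    split=> /=; last exact: near_infty_natSinv_lt (PosNum r2).
    apply: filterI => //.
    have c3 : continuous (fun ys : Y * I => itv_val ys.2).
      exact: (cts_comp itv_val_continuous (@cts_snd _ _)).
    by move/cvgrPdist_lt : (c3 (y0, s0)); apply.
  move=> [[y s] n] /= [[hWys hs] hn] t st.
  apply: (WV ((y, s), t)); split=> //=; apply: rV.
  apply: (le_lt_trans (ler_distD (itv_val s) _ _)); rewrite (splitr r).
  by apply: ltrD => //; exact: le_lt_trans st hn.
move=> H; near \oo => n; exists n => y s t.
have h : [set: Y * I] `<=` [set ys | forall t,
    `|itv_val ys.2 - itv_val t| <= n.+1%:R^-1 -> N (Phi ys) (Phi (ys.1, t))] by near: n.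
exact: (h (y, s) Logic.I t).
Unshelve. all: by end_near. Qed.

End Subdivision.

(* The lift follows Phi by transporting with l along the subdivision points
   min (t, i / n); since l e (p e) = e, no gluing is needed. *)
Lemma transport_lift {Y E B : topologicalType} (p : E -> B) (l : E -> B -> E)
    (N : B -> B -> Prop) (Phi : Y * I -> B) (z : Y -> E) :
  (forall b, N b b) ->
  (forall (T : topologicalType) (f g : T -> B) (t : T),
    continuous f -> continuous g -> N (f t) (g t) -> \forall u \near t, N (f u) (g u)) ->
  (forall (T : topologicalType) (f : T -> E) (g : T -> B),
    continuous f -> continuous g -> continuous (fun t => l (f t) (g t))) ->
  (forall e b, N (p e) b -> p (l e b) = b) ->
  (forall e, l e (p e) = e) ->
  compact [set: Y] -> continuous Phi -> continuous z -> (forall y, p (z y) = Phi (y, zero)) ->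
  exists Z : Y * I -> E, [/\ continuous Z,
    forall u, p (Z u) = Phi u, forall y, Z (y, zero) = z y &
    forall y, (forall t, Phi (y, t) = Phi (y, zero)) -> forall t, Z (y, t) = z y].
Proof.
move=> N_refl N_open cl hl hid cY cPhi cz pz.
have [n hn] := uniform_subdivision cY cPhi N_refl N_open.
pose m (i : nat) (t : I) : I := clamp (Num.min (itv_val t) (i%:R / n.+1%:R)).
have n0 : 0 < n.+1%:R :> R by rewrite ltr0n.
have q0 (i : nat) : 0 <= i%:R / n.+1%:R :> R by rewrite divr_ge0.
have mv i t : itv_val (m i t) = Num.min (itv_val t) (i%:R / n.+1%:R).
  rewrite clampK // ?le_min ?ge_min ?itv_val_ge0 ?itv_val_le1 //=.
have cm i : continuous (m i).
  by apply/cts_clamp/cts_min; [exact: itv_val_continuous|exact: cts_cst].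
have m0 i : m i zero = zero.
  by rewrite /m itv_val0 (min_idPl _) // -itv_val0 itv_valK.
have mS i t : `|itv_val (m i t) - itv_val (m i.+1 t)| <= n.+1%:R^-1.
  rewrite !mv -(@natr1 R i) mulrDl mul1r.
  have : 0 < n.+1%:R^-1 :> R by rewrite invr_gt0.
  move: (n.+1%:R^-1) (i%:R / n.+1%:R) (itv_val t) => c a b c0.
  by rewrite ler_norml; case: (leP b a); case: (leP b (a + c)); lra.
pose Z := fix Z (i : nat) (u : Y * I) : E :=
  if i is j.+1 then l (Z j u) (Phi (u.1, m i u.2)) else z u.1.
have HZ i : [/\ continuous (Z i), forall y t, p (Z i (y, t)) = Phi (y, m i t),
    forall y, Z i (y, zero) = z y &
    forall y, (forall t, Phi (y, t) = Phi (y, zero)) -> forall t, Z i (y, t) = z y].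
  elim: i => [|i [IHc IHp IH0 IHs]].
    split=> //=; first exact: (cts_comp cz (@cts_fst _ _)).
    move=> y t; rewrite pz; congr (Phi (y, _)).
    by rewrite /m mul0r (min_idPr _) ?itv_val_ge0 // clamp_le0.
  have step y t : N (p (Z i (y, t))) (Phi (y, m i.+1 t)) by rewrite IHp; exact: hn.
  split.
  - apply: cl => //; apply: (cts_comp cPhi).
    apply: cts_pair; first exact: cts_fst.
    exact: (cts_comp (cm i.+1) (@cts_snd _ _)).
  - by move=> y t; exact: hl (step y t).
  - by move=> y /=; rewrite IH0 m0 -pz hid.
  (* Where [Phi] is stationary, each transport goes from a point to its own image and [hid] leaves
     it fixed. *)
  - move=> y hy t /=; rewrite IHs //.
    by rewrite hy -pz hid.
have [Zc Zp Z0 Zs] := HZ n.+1; exists (Z n.+1); split=> //.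
move=> [y t]; rewrite Zp; congr (Phi (y, _)).
by rewrite /m divff ?gt_eqF // (min_idPl _) ?itv_val_le1 // itv_valK.
Qed.

End Lifting.

(** * Parallel transport for the Hopf map *)

Section HopfLift.
Context {R : realType}.
Local Notation I := (unit_itv R).

Definition dot (q q' : S2 R) : R :=
  (S2_val q).1.1 * (S2_val q').1.1 + (S2_val q).1.2 * (S2_val q').1.2 +
  (S2_val q).2 * (S2_val q').2.

(* Twice the image of z under the rank one projector (1 + q . sigma) / 2 of C^2. *)
Definition proj_coord (z : S3 R) (q : S2 R) (i : nat) : R :=
  match i with
  | 0 => (1 + (S2_val q).2) * s3c k0 z + (S2_val q).1.1 * s3c k2 z - (S2_val q).1.2 * s3c k3 z
  | 1 => (1 + (S2_val q).2) * s3c k1 z + (S2_val q).1.1 * s3c k3 z + (S2_val q).1.2 * s3c k2 z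
  | 2 => (S2_val q).1.1 * s3c k0 z + (S2_val q).1.2 * s3c k1 z + (1 - (S2_val q).2) * s3c k2 z
  | _ => (S2_val q).1.1 * s3c k1 z - (S2_val q).1.2 * s3c k0 z + (1 - (S2_val q).2) * s3c k3 z
  end.

(* The second summand keeps the vector nonzero when q is far from hopf z. *)
Definition transport_coord z q (i : 'I_4) : R :=
  proj_coord z q i + Num.max 0 (- dot (hopf z) q) * s3c i z.

Definition transport_vec (z : S3 R) (q : S2 R) : 'rV[R]_4 := \row_i transport_coord z q i.

Lemma transport_vecE z q i : transport_vec z q ord0 i = transport_coord z q i.
Proof. by rewrite mxE. Qed.

Lemma dot_hopf z q : dot (hopf z) q =
  2 * (s3c k0 z * s3c k2 z + s3c k1 z * s3c k3 z) * (S2_val q).1.1 +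
  2 * (s3c k1 z * s3c k2 z - s3c k0 z * s3c k3 z) * (S2_val q).1.2 +
  (s3c k0 z ^+ 2 + s3c k1 z ^+ 2 - (s3c k2 z ^+ 2 + s3c k3 z ^+ 2)) * (S2_val q).2.
Proof. by rewrite /dot hopf_coord. Qed.

Lemma dot_self (q : S2 R) : dot q q = 1.
Proof. by rewrite /dot -[RHS](S2P q); ring. Qed.

Lemma dot_geN1 (q q' : S2 R) : -1 <= dot q q'.
Proof.
have := S2P q; have := S2P q'; rewrite /dot.
move: (S2_val q) (S2_val q') => [[x y] h] [[x' y'] h'] /= e e'.
have : 0 <= (x + x') ^+ 2 + (y + y') ^+ 2 + (h + h') ^+ 2.
  by rewrite !addr_ge0 ?sqr_ge0.
have -> : (x + x') ^+ 2 + (y + y') ^+ 2 + (h + h') ^+ 2 =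
  (x ^+ 2 + y ^+ 2 + h ^+ 2) + (x' ^+ 2 + y' ^+ 2 + h' ^+ 2) +
  2 * (x * x' + y * y' + h * h') by ring.
rewrite e e'; lra.
Qed.

(** Its inner product with [z] in R^4 is 1 + dot + max(0, - dot), where dot is that of [hopf z] and
    [q]; this is positive. *)
Lemma transport_vec_neq0 z q : transport_vec z q != 0.
Proof.
apply/eqP => E.
have Ej j : transport_coord z q j = 0 by rewrite -transport_vecE E mxE.
have d1 := dot_geN1 (hopf z) q.
have : (1 + dot (hopf z) q) + Num.max 0 (- dot (hopf z) q) = 0.
  have e0 := Ej k0; have e1 := Ej k1; have e2 := Ej k2; have e3 := Ej k3.
  move: e0 e1 e2 e3 (s3c_sq z); rewrite /transport_coord /=.
  move: (Num.max _ _) => mx; rewrite dot_hopf.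
  move: (S2_val q) (s3c k0 z) (s3c k1 z) (s3c k2 z) (s3c k3 z) => [[x y] h] a b c d /=.
  move=> e0 e1 e2 e3 n.
  set D := (D in 1 + D + _).
  transitivity ((a ^+ 2 + b ^+ 2 + c ^+ 2 + d ^+ 2) * (1 + mx) + D).
    by rewrite n; ring.
  transitivity (a * ((1 + h) * a + x * c - y * d + mx * a) +
    b * ((1 + h) * b + x * d + y * c + mx * b) +
    c * (x * a + y * b + (1 - h) * c + mx * c) +
    d * (x * b - y * a + (1 - h) * d + mx * d)); first by rewrite /D; ring.
  by rewrite e0 e1 e2 e3 !mulr0 !addr0.
by case: (leP 0 (- dot (hopf z) q)); lra.
Qed.

Definition hopf_transport (z : S3 R) (q : S2 R) : S3 R :=
  normalize (transport_vec_neq0 z q).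

Lemma dot_continuous (T : topologicalType) (f g : T -> S2 R) :
  continuous f -> continuous g -> continuous (fun t => dot (f t) (g t)).
Proof.
move=> cf cg.
have c1 := cts_comp (@S2_val_continuous R) cf; have c2 := cts_comp (@S2_val_continuous R) cg.
apply: cts_add; first apply: cts_add; apply: cts_mul.
- exact: (cts_comp (@cts_fst _ _) (cts_comp (@cts_fst _ _) c1)).
- exact: (cts_comp (@cts_fst _ _) (cts_comp (@cts_fst _ _) c2)).
- exact: (cts_comp (@cts_snd _ _) (cts_comp (@cts_fst _ _) c1)).
- exact: (cts_comp (@cts_snd _ _) (cts_comp (@cts_fst _ _) c2)).
- exact: (cts_comp (@cts_snd _ _) c1).
- exact: (cts_comp (@cts_snd _ _) c2).
Qed.

Lemma hopf_transport_continuous (T : topologicalType) (f : T -> S3 R) (g : T -> S2 R) :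
  continuous f -> continuous g -> continuous (fun t => hopf_transport (f t) (g t)).
Proof.
move=> cf cg.
have cs i : continuous (fun t => s3c i (f t)) := cts_comp (@s3c_continuous R i) cf.
have cq : continuous (fun t => S2_val (g t)) := cts_comp (@S2_val_continuous R) cg.
have cx : continuous (fun t => (S2_val (g t)).1.1).
  exact: (cts_comp (@cts_fst _ _) (cts_comp (@cts_fst _ _) cq)).
have cy : continuous (fun t => (S2_val (g t)).1.2).
  exact: (cts_comp (@cts_snd _ _) (cts_comp (@cts_fst _ _) cq)).
have ch : continuous (fun t => (S2_val (g t)).2).
  exact: (cts_comp (@cts_snd _ _) cq).
have cd : continuous (fun t => dot (hopf (f t)) (g t)).
  by apply: dot_continuous => //; exact: (cts_comp (@hopf_continuous R) cf).
have cm : continuous (fun t => Num.max 0 (- dot (hopf (f t)) (g t))).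
  apply: cts_max; first exact: cts_cst.
  by move=> u; apply: cvgN; exact: cd.
have c1h : continuous (fun t => 1 + (S2_val (g t)).2).
  by apply: cts_add => //; exact: cts_cst.
have c2h : continuous (fun t => 1 - (S2_val (g t)).2).
  by apply: cts_sub => //; exact: cts_cst.
have E i : continuous (fun t => transport_coord (f t) (g t) i).
  apply: cts_add; last exact: cts_mul.
  move: i; apply: ord4_ind => /=.
  - by apply: cts_sub; [apply: cts_add|]; exact: cts_mul.
  - by apply: cts_add; [apply: cts_add|]; exact: cts_mul.
  - by apply: cts_add; [apply: cts_add|]; exact: cts_mul.
  - by apply: cts_add; [apply: cts_sub|]; exact: cts_mul.
have cv : continuous (fun t => transport_vec (f t) (g t)).
  apply: cts_mx => i j.
  rewrite (_ : (fun _ => _) = fun t => transport_coord (f t) (g t) j) //.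
  by apply/funext => u; rewrite mxE.
exact: (@normalize_continuous R _ _ (fun t => transport_vec_neq0 (f t) (g t)) cv).
Qed.

Lemma hopf_normalize (x : 'rV[R]_4) (h : x != 0) : S2_val (hopf (normalize h)) =
  (2 * (x ord0 k0 * x ord0 k2 + x ord0 k1 * x ord0 k3) / normsq x,
   2 * (x ord0 k1 * x ord0 k2 - x ord0 k0 * x ord0 k3) / normsq x,
   (x ord0 k0 ^+ 2 + x ord0 k1 ^+ 2 - (x ord0 k2 ^+ 2 + x ord0 k3 ^+ 2)) / normsq x).
Proof.
have n0 := normsq_gt0 h.
have [r [r0 rE nE]] : exists r, [/\ r != 0, Num.sqrt (normsq x) = r & normsq x = r ^+ 2].
  exists (Num.sqrt (normsq x)); split=> //; last by rewrite sqr_sqrtr ?ltW.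
  by rewrite sqrtr_eq0 -ltNge.
rewrite hopf_coord !normalize_coord rE nE.
by congr (_, _, _); field.
Qed.

Lemma S2_val_inj : injective (@S2_val R).
Proof. exact: val_inj. Qed.

(** For positive [dot] the correction vanishes and the vector lies in the image of the projector of
    [q], the complex line whose unit vectors form the fibre over [q]. *)
Lemma hopf_transportK z q : 0 < dot (hopf z) q -> hopf (hopf_transport z q) = q.
Proof.
move=> d0; apply: S2_val_inj; rewrite hopf_normalize /=.
have m0 : Num.max 0 (- dot (hopf z) q) = 0 by rewrite (max_idPl _) //; lra.
have := normsq_gt0 (transport_vec_neq0 z q).
rewrite /normsq !transport_vecE /transport_coord m0 !mul0r !addr0 /=.
have := S2P q; have := s3c_sq z.
move: (S2_val q) (s3c k0 z) (s3c k1 z) (s3c k2 z) (s3c k3 z) => [[x y] h] a b c d /=.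
move=> n1 q1.
set u0 := _ - y * d; set u1 := _ + y * c; set u2 := _ + (1 - h) * c.
set u3 := _ + (1 - h) * d => /lt0r_neq0 n0.
have q0 : 1 - (x ^+ 2 + y ^+ 2 + h ^+ 2) = 0 by rewrite q1 subrr.
congr (_, _, _); apply: (canLR (mulfK n0)).
(* The equality holds modulo the equation of S^2; the multiple of 1 - |q|^2 is made explicit so that
   a polynomial identity remains. *)
- transitivity (x * (u0 ^+ 2 + u1 ^+ 2 + u2 ^+ 2 + u3 ^+ 2) +
    (1 - (x ^+ 2 + y ^+ 2 + h ^+ 2)) *
    (x * (a ^+ 2 + b ^+ 2 + c ^+ 2 + d ^+ 2) + 2 * (a * c + b * d))).
    by rewrite /u0 /u1 /u2 /u3; ring.
  by rewrite q0 mul0r addr0.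
- transitivity (y * (u0 ^+ 2 + u1 ^+ 2 + u2 ^+ 2 + u3 ^+ 2) +
    (1 - (x ^+ 2 + y ^+ 2 + h ^+ 2)) *
    (y * (a ^+ 2 + b ^+ 2 + c ^+ 2 + d ^+ 2) + 2 * (b * c - a * d))).
    by rewrite /u0 /u1 /u2 /u3; ring.
  by rewrite q0 mul0r addr0.
- transitivity (h * (u0 ^+ 2 + u1 ^+ 2 + u2 ^+ 2 + u3 ^+ 2) +
    (1 - (x ^+ 2 + y ^+ 2 + h ^+ 2)) *
    (h * (a ^+ 2 + b ^+ 2 + c ^+ 2 + d ^+ 2) + (a ^+ 2 + b ^+ 2 - (c ^+ 2 + d ^+ 2)))).
    by rewrite /u0 /u1 /u2 /u3; ring.
  by rewrite q0 mul0r addr0.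
Qed.

Lemma normalize_double (z : S3 R) (h : 2 *: s3vec z != 0) : normalize h = z.
Proof.
have E : normsq (2 *: s3vec z) = 2 ^+ 2.
  by rewrite -[RHS]mulr1 -(s3c_sq z) /normsq !mxE; ring.
apply: S3_eq => i; rewrite normalize_coord E sqrtr_sqr ger0_norm // !mxE.
by rewrite mulrC mulKf.
Qed.

Lemma hopf_transport_id z : hopf_transport z (hopf z) = z.
Proof.
have E : transport_vec z (hopf z) = 2 *: s3vec z.
  have m0 : Num.max 0 (- dot (hopf z) (hopf z)) = 0.
    by rewrite dot_self (max_idPl _) //; lra.
  apply/rowP => i; rewrite transport_vecE /transport_coord m0 mul0r addr0 !mxE.
  rewrite /proj_coord hopf_coord; have := s3c_sq z; move: i; apply: ord4_ind => /=;
  move: (s3c k0 z) (s3c k1 z) (s3c k2 z) (s3c k3 z) => a b c d n.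
  - by transitivity (a * (1 + (a ^+ 2 + b ^+ 2 + c ^+ 2 + d ^+ 2))); [ring|rewrite n; ring].
  - by transitivity (b * (1 + (a ^+ 2 + b ^+ 2 + c ^+ 2 + d ^+ 2))); [ring|rewrite n; ring].
  - by transitivity (c * (1 + (a ^+ 2 + b ^+ 2 + c ^+ 2 + d ^+ 2))); [ring|rewrite n; ring].
  - by transitivity (d * (1 + (a ^+ 2 + b ^+ 2 + c ^+ 2 + d ^+ 2))); [ring|rewrite n; ring].
rewrite /hopf_transport; move: (transport_vec_neq0 _ _); rewrite /= E => h.
exact: normalize_double.
Qed.

Lemma hopf_lift {Y : topologicalType} (Phi : Y * I -> S2 R) (z : Y -> S3 R) :
  compact [set: Y] -> continuous Phi -> continuous z ->
  (forall y, hopf (z y) = Phi (y, zero)) ->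
  exists Z : Y * I -> S3 R, [/\ continuous Z,
    forall u, hopf (Z u) = Phi u, forall y, Z (y, zero) = z y &
    forall y, (forall t, Phi (y, t) = Phi (y, zero)) -> forall t, Z (y, t) = z y].
Proof.
move=> cY cPhi cz pz.
apply: (transport_lift (N := fun q q' => 0 < dot q q') _ _ hopf_transport_continuous
  hopf_transportK hopf_transport_id cY cPhi cz pz) => [q|T f g t cf cg h].
  by rewrite dot_self.
exact: (dot_continuous cf cg (lt_nbhsr h)).
Qed.

End HopfLift.

(** * The circle *)

Definition S1 (R : realType) : Type :=
  set_type [set w : R * R | w.1 ^+ 2 + w.2 ^+ 2 = 1].

HB.instance Definition _ (R : realType) := Topological.on (S1 R).

Section Circle.
Context {R : realType}.
Local Notation I := (unit_itv R).

Definition S1_val (w : S1 R) : R * R := \val w.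

Lemma S1P (w : S1 R) : (S1_val w).1 ^+ 2 + (S1_val w).2 ^+ 2 = 1.
Proof. exact: (set_valP w). Qed.

Lemma S1_val_inj : injective S1_val.
Proof. exact: val_inj. Qed.

Definition S1_mk (x y : R) (h : x ^+ 2 + y ^+ 2 = 1) : S1 R :=
  exist (fun w => w \in [set w : R * R | w.1 ^+ 2 + w.2 ^+ 2 = 1]) (x, y)
        (mem_set (h : [set w : R * R | w.1 ^+ 2 + w.2 ^+ 2 = 1] (x, y))).

Lemma S1_val_continuous : continuous S1_val.
Proof. exact: initial_continuous. Qed.

Lemma S1_continuous (T : topologicalType) (f : T -> S1 R) :
  continuous (fun t => (S1_val (f t)).1) -> continuous (fun t => (S1_val (f t)).2) ->
  continuous f.
Proof.
move=> c1 c2; apply: continuous_comp_initial.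
rewrite (_ : _ \o _ = fun t => ((S1_val (f t)).1, (S1_val (f t)).2)).
  exact: cts_pair.
by apply/funext => t; rewrite -surjective_pairing.
Qed.

Definition cis (t : R) : S1 R := S1_mk (cos2Dsin2 t).

Lemma cis_val (t : R) : S1_val (cis t) = (cos t, sin t).
Proof. by []. Qed.

Lemma cisD_eq (a b c : R) : cis a = cis b -> cis (a + c) = cis (b + c).
Proof.
move=> /(congr1 S1_val)[ec es]; apply: S1_val_inj; rewrite !cis_val.
by rewrite !cosD !sinD ec es.
Qed.

Lemma cis_eq_near (a b : R) : cis a = cis b -> `|a - b| < 1 -> a = b.
Proof.
move=> /(congr1 S1_val)[ec es] ab.
wlog le_ba : a b ec es ab / b <= a.
  move=> W; have [h|h] := leP b a; first exact: W.
  by apply/esym/W; rewrite ?(ltW h) // distrC.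
have c1 : cos (a - b) = 1 by rewrite cosB ec es -!expr2 cos2Dsin2.
apply/eqP; rewrite -subr_eq0; apply/eqP.
move: ab; rewrite ger0_norm ?subr_ge0 // => ab.
apply: (@cos_inj R); rewrite ?cos0 // in_itv /= ?lexx ?pi_ge0 // subr_ge0 le_ba /=.
have := @pi_ge2 R; lra.
Qed.

(** The fibres of [cis] are discrete by [cis_eq_near], so the level sets of [f] are open and
    closed. *)
Lemma connected_cis_const (X : topologicalType) (f : X -> R) :
  connected [set: X] -> continuous f -> (forall x y, cis (f x) = cis (f y)) ->
  forall x y, f x = f y.
Proof.
move=> cX cf fE x y.
have loc z : \forall w \near z, f w = f z.
  have : \forall w \near z, `|f z - f w| < 1.
    by move/cvgrPdist_lt : (cf z); apply.
  by apply: filterS => w h; apply: cis_eq_near => //; rewrite distrC.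
have oA : open [set z | f z = f x].
  by rewrite openE => z /= <-; exact: loc.
have cA : closed [set z | f z = f x].
  rewrite -openC openE => z /= h; rewrite /interior.
  by have := loc z; apply: filterS => w /= ->.
have AT : [set z | f z = f x] = [set: X].
  apply: cX.
  - by exists x.
  - by exists [set z | f z = f x]; rewrite // setTI.
  - by exists [set z | f z = f x]; rewrite // setTI.
by apply/esym; rewrite -[_ = _]/([set z | f z = f x] y) AT.
Qed.

Lemma unit_itv_connected : connected [set: I].
Proof.
rewrite (_ : [set: I] = clamp @` `[0, 1]%classic).
  apply: connected_continuous_connected; first exact: segment_connected.
  by apply: continuous_subspaceT; exact: clamp_continuous.
apply/seteqP; split=> // t _; exists (itv_val t); last exact: itv_valK.
by rewrite /= in_itv /= itv_val_ge0 itv_val_le1.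
Qed.

Definition cdot (u v : S1 R) : R :=
  (S1_val u).1 * (S1_val v).1 + (S1_val u).2 * (S1_val v).2.

(* theta plus the argument of w / cis theta, when this quotient has real part
   at least 1 / 2. *)
Definition arg_transport (t : R) (w : S1 R) : R :=
  t + atan ((cos t * (S1_val w).2 - sin t * (S1_val w).1) /
            Num.max (1 / 2) (cdot (cis t) w)).

Lemma cdot_continuous (T : topologicalType) (f g : T -> S1 R) :
  continuous f -> continuous g -> continuous (fun t => cdot (f t) (g t)).
Proof.
move=> cf cg.
have c1 := cts_comp S1_val_continuous cf; have c2 := cts_comp S1_val_continuous cg.
apply: cts_add; apply: cts_mul.
- exact: (cts_comp (@cts_fst _ _) c1).
- exact: (cts_comp (@cts_fst _ _) c2).
- exact: (cts_comp (@cts_snd _ _) c1).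
- exact: (cts_comp (@cts_snd _ _) c2).
Qed.

Lemma cis_continuous : continuous cis.
Proof. by apply: S1_continuous; [exact: continuous_cos|exact: continuous_sin]. Qed.

Lemma arg_transport_continuous (T : topologicalType) (f : T -> R) (g : T -> S1 R) :
  continuous f -> continuous g -> continuous (fun t => arg_transport (f t) (g t)).
Proof.
move=> cf cg; have cS := cts_comp S1_val_continuous cg.
apply: cts_add => //; apply: (cts_comp (@continuous_atan R)); apply: cts_mul.
  apply: cts_sub; apply: cts_mul.
  - exact: (cts_comp (@continuous_cos R) cf).
  - exact: (cts_comp (@cts_snd _ _) cS).
  - exact: (cts_comp (@continuous_sin R) cf).
  - exact: (cts_comp (@cts_fst _ _) cS).
move=> u; apply: at_inv.
  by rewrite gt_eqF // lt_max; apply/orP; left; lra.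
move: u; apply: cts_max; first exact: cts_cst.
by apply: cdot_continuous => //; exact: (cts_comp cis_continuous cf).
Qed.

Lemma arg_transportK (t : R) w : 1 / 2 < cdot (cis t) w -> cis (arg_transport t w) = w.
Proof.
move=> h; have {}h : 1 / 2 < cos t * (S1_val w).1 + sin t * (S1_val w).2 by [].
rewrite /arg_transport /= (max_idPr _); last exact: ltW.
have -> : cdot (cis t) w = cos t * (S1_val w).1 + sin t * (S1_val w).2 by [].
apply: S1_val_inj; rewrite cis_val; have := S1P w; case: (S1_val w) h => [x y] /= h xy.
(* C + i S is the quotient of w by cis t. As C > 0, the angle atan (S / C) has cosine C and sine
   S. *)
set C := cos t * x + sin t * y in h *; set S := cos t * y - sin t * x.
have cs := cos2Dsin2 t.
have C0 : 0 < C by lra.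
have CS : C ^+ 2 + S ^+ 2 = 1.
  transitivity ((cos t ^+ 2 + sin t ^+ 2) * (x ^+ 2 + y ^+ 2)); first by rewrite /C /S; ring.
  by rewrite cs xy mulr1.
have cC : cos (atan (S / C)) = C.
  rewrite cos_atan (_ : 1 + (S / C) ^+ 2 = (C^-1) ^+ 2).
    by rewrite sqrtr_sqr ger0_norm ?invrK // invr_ge0 ltW.
  transitivity ((C ^+ 2 + S ^+ 2) / C ^+ 2); first by field; rewrite gt_eqF.
  by rewrite CS div1r exprVn.
have sS : sin (atan (S / C)) = S.
  have := @atanK R (S / C); rewrite /tan cC => /(congr1 (fun z => z * C)).
  by rewrite !divfK // gt_eqF.
rewrite cosD sinD cC sS; congr (_, _).
  transitivity (x * (cos t ^+ 2 + sin t ^+ 2)); first by rewrite /C /S; ring.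
  by rewrite cs mulr1.
transitivity (y * (cos t ^+ 2 + sin t ^+ 2)); first by rewrite /C /S; ring.
by rewrite cs mulr1.
Qed.

Lemma arg_transport_id t : arg_transport t (cis t) = t.
Proof. by rewrite /arg_transport cis_val /= (mulrC (sin t)) subrr mul0r atan0 addr0. Qed.

Lemma cdot_self w : cdot w w = 1.
Proof. by rewrite /cdot -!expr2 S1P. Qed.

Lemma cdot_near (w : S1 R) : \forall v \near w, 1 / 2 < cdot w v.
Proof.
have c : continuous (cdot w).
  by apply: cdot_continuous; [exact: cts_cst|exact: cts_id].
by apply: (c w _ (lt_nbhsr _)); rewrite cdot_self; lra.
Qed.

Lemma circle_lift {Y : topologicalType} (Phi : Y * I -> S1 R) (z : Y -> R) :
  compact [set: Y] -> continuous Phi -> continuous z ->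
  (forall y, cis (z y) = Phi (y, zero)) ->
  exists Z : Y * I -> R, [/\ continuous Z,
    forall u, cis (Z u) = Phi u, forall y, Z (y, zero) = z y &
    forall y, (forall t, Phi (y, t) = Phi (y, zero)) -> forall t, Z (y, t) = z y].
Proof.
move=> cY cPhi cz pz.
apply: (transport_lift (N := fun q q' => 1 / 2 < cdot q q') _ _ arg_transport_continuous
  arg_transportK arg_transport_id cY cPhi cz pz) => [q|T f g t cf cg h].
  by rewrite cdot_self; lra.
exact: (cdot_continuous cf cg (lt_nbhsr h)).
Qed.

End Circle.

(** * Logarithms of circle-valued maps *)

Section Winding.
Context {R : realType} {M : topologicalType} (lam : M -> S1 R).
Context (clam : continuous lam).
Local Notation I := (unit_itv R).

Definition lifts (p : I -> M) (P : I -> R) : Prop := forall t, cis (P t) = lam (p t).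

Lemma lifts_unique (p : I -> M) (P Q : I -> R) : continuous P -> continuous Q ->
  lifts p P -> lifts p Q -> P zero = Q zero -> forall t, P t = Q t.
Proof.
move=> cP cQ hP hQ PQ0 t; apply/eqP; rewrite -subr_eq0; apply/eqP.
have E s : cis (P s - Q s) = cis 0.
  by rewrite -(subrr (Q s)); apply: cisD_eq; rewrite hP hQ.
have <- : P zero - Q zero = 0 by rewrite PQ0 subrr.
apply: (@connected_cis_const _ _ (fun t => P t - Q t)) => //.
- exact: unit_itv_connected.
- exact: cts_sub.
- by move=> x y; rewrite !E.
Qed.

Lemma path_lift {x y : M} (p : {path I from x to y}) (a : R) : cis a = lam x ->
  exists (b : R) (P : {path I from a to b}), lifts p P.
Proof.
move=> ax.
(* [I] merely serves as a nonempty compact parameter space; the lift is read off at parameter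
   [zero]. *)
have [||y0|Z [cZ hZ Z0 _]] := @circle_lift R I (fun u => lam (p u.2)) (fun=> a) unit_itv_compact.
- apply: (cts_comp clam); apply: (cts_comp (@cts_fun _ _ p)); exact: cts_snd.
- exact: cts_cst.
- by rewrite /= path_zero.
have cZ' : continuous (fun t => Z (zero, t)).
  by apply: (cts_comp cZ); apply: cts_pair; [exact: cts_cst|exact: cts_id].
exists (Z (zero, one)), (mk_path cZ' (Z0 zero) erefl) => t.
by rewrite /= hZ.
Qed.

(** Lift the homotopy along path time, with the homotopy parameter as a point of the base. The end
    points of the lifted paths lie over the fixed point [y], hence in one fibre of [cis], and vary
    continuously, so they are constant. *)
Lemma homotopic_lift_endpoint {x y : M} (p q : {path I from x to y}) a b b'
    (P : {path I from a to b}) (Q : {path I from a to b'}) :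
  path_homotopic p q -> lifts p P -> lifts q Q -> b = b'.
Proof.
move=> [H [cH H0 H1 Hs]] hP hQ.
have ax : cis a = lam x by rewrite -(path_zero (s := P)) hP path_zero.
have [||s|Z [cZ hZ Z0 _]] := @circle_lift R I (fun u => lam (H (u.2, u.1))) (fun=> a) unit_itv_compact.
- apply: (cts_comp clam); apply: (cts_comp cH).
  by apply: cts_pair; [exact: cts_snd|exact: cts_fst].
- exact: cts_cst.
- by rewrite /= (Hs s).1.
have cZt s : continuous (fun t => Z (s, t)).
  by apply: (cts_comp cZ); apply: cts_pair; [exact: cts_cst|exact: cts_id].
have cZ1 : continuous (fun s => Z (s, one)).
  by apply: (cts_comp cZ); apply: cts_pair; [exact: cts_id|exact: cts_cst].
have E : Z (zero, one) = Z (one, one).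
  apply: (connected_cis_const unit_itv_connected cZ1) => s s'.
  by rewrite !hZ /= (Hs s).2 (Hs s').2.
have <- : Z (zero, one) = b.
  rewrite -(path_one (s := P)); apply: (@lifts_unique p _ _ (cZt zero) (@cts_fun _ _ P)) => //.
    by move=> t; rewrite hZ /= H0.
  by rewrite Z0; exact: (esym (path_zero (s := P))).
rewrite E -(path_one (s := Q)); apply: (@lifts_unique q _ _ (cZt one) (@cts_fun _ _ Q)) => //.
  by move=> t; rewrite hZ /= H1.
by rewrite Z0; exact: (esym (path_zero (s := Q))).
Qed.

Lemma lifts_concat {x y z : M} (p : {path I from x to y}) (q : {path I from y to z})
    a b c (P : {path I from a to b}) (Q : {path I from b to c}) :
  lifts p P -> lifts q Q -> lifts (concat p q) (concat P Q).
Proof.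
move=> hP hQ t; rewrite !concatE /concat_line /path_line /=.
by case: ifP => _; [exact: hP|exact: hQ].
Qed.

Lemma lifts_reverse {x y : M} (p : {path I from x to y}) a b (P : {path I from a to b}) :
  lifts p P -> lifts (reverse p) (reverse P).
Proof. by move=> hP t; rewrite !reverseE /path_line /=. Qed.

Lemma lifts_shift {x y : M} (p : {path I from x to y}) a b a' (P : {path I from a to b}) :
  lifts p P -> cis a' = cis a ->
  exists Q : {path I from a' to a' + (b - a)}, lifts p Q.
Proof.
move=> hP aa'.
have cQ : continuous (fun t => a' + (P t - a)).
  by apply: cts_add; [exact: cts_cst|apply: cts_sub; [exact: cts_fun|exact: cts_cst]].
have Q0 : a' + (P zero - a) = a' by rewrite path_zero subrr addr0.
have Q1 : a' + (P one - a) = a' + (b - a) by rewrite path_one.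
exists (mk_path cQ Q0 Q1) => t; rewrite -hP /=.
by rewrite (cisD_eq _ aa') addrCA subrr addr0.
Qed.

Context (p0 : M) (lam0 : lam p0 = cis 0) (fin : finite_set [set: pi1 R p0]).

(* The lift of a loop representing a^n ends at n times the endpoint for a. *)
Lemma loop_lift_closed (p : loop R p0) b (P : {path I from 0 to b}) : lifts p P -> b = 0.
Proof.
have hw (a : pi1 R p0) : exists b (P : {path I from 0 to b}), lifts (repr a) P.
  by apply: path_lift; rewrite lam0.
have [w wP] := choice hw.
have wE (q : loop R p0) c (Q : {path I from 0 to c}) : lifts q Q -> w (loop_class q) = c.
  move=> hQ; have [W hW] := wP (loop_class q).
  exact: homotopic_lift_endpoint (path_homotopic_repr q) hW hQ.
have wM a c : w (pi1_mul a c) = w a + w c.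
  have [A hA] := wP a; have [C hC] := wP c.
  have wa0 : cis (w a) = cis 0 by rewrite -(path_one (s := A)) hA path_one.
  have [C' hC'] := lifts_shift hC wa0.
  rewrite (wE _ _ _ (lifts_concat hA hC')); by rewrite subr0.
move=> hP; rewrite -(wE _ _ _ hP); move: (loop_class p) => a.
apply: contrapT => wa.
(* The iteration starts at [a], so the element is a^(n+1). If [w a] were nonzero, all these powers
   would be distinct. *)
have wn n : w (iter n (pi1_mul a) a) = w a *+ n.+1.
  by elim: n => [|n IH] //=; rewrite wM IH -mulrS.
have inj : injective (fun n => iter n (pi1_mul a) a).
  move=> n m /(congr1 w); rewrite !wn => /eqP; rewrite -subr_eq0.
  wlog nm : n m / (m <= n)%N.
    move=> W; have /orP[h|h] := leq_total m n; first exact: W.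
    by rewrite -oppr_eq0 opprB => /(W _ _ h).
  rewrite -mulrnBr ?ltnS // mulrn_eq0; move/eqP/negPf : wa => ->; rewrite orbF.
  by rewrite subSS subn_eq0 => h; apply/eqP; rewrite eqn_leq h.
apply: infinite_nat.
have := @finite_preimage _ _ [set: pi1 R p0] (fun n => iter n (pi1_mul a) a).
by rewrite preimage_setT; apply=> // n m _ _; exact: inj.
Qed.

(** Going along [p] and back along [p'] gives a loop at [p0] whose lift ends at r - r'. Hence a
    logarithm defined through paths does not depend on them. *)
Lemma lift_endpoint_unique {x : M} (p p' : {path I from p0 to x}) r r'
    (P : {path I from 0 to r}) (P' : {path I from 0 to r'}) :
  lifts p P -> lifts p' P' -> r = r'.
Proof.
move=> hP hP'.
have rr' : cis r = cis r'.
  by rewrite -(path_one (s := P)) -(path_one (s := P')) hP hP' !path_one.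
have [Q hQ] := lifts_shift (lifts_reverse hP') rr'.
have := loop_lift_closed (lifts_concat hP hQ); lra.
Qed.

Context (loc : forall (x : M) (U : set M), nbhs x U -> exists2 W, nbhs x W &
  forall y, W y -> exists q : {path I from x to y}, forall t, U (q t)).

Lemma all_reachable : connected [set: M] -> forall x, exists p : {path I from p0 to x}, True.
Proof.
move=> cM.
pose A := [set x | exists p : {path I from p0 to x}, True].
have oA : open A.
  rewrite openE => x [p _]; have [W xW hW] := loc (@filterT _ (nbhs x) _).
  by apply: filterS xW => y /hW[q _]; exists (concat p q).
have cA : closed A.
  rewrite -openC openE => x nx; have [W xW hW] := loc (@filterT _ (nbhs x) _).
  apply: filterS xW => y /hW[q _] [p _]; apply: nx.
  by exists (concat p (reverse q)).
have : A = [set: M].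
  apply: cM.
  - by exists p0, (cst_path p0).
  - by exists A; rewrite // setTI.
  - by exists A; rewrite // setTI.
by move=> AT x; rewrite -[exists p, _]/(A x) AT.
Qed.

Lemma circle_log : connected [set: M] ->
  exists th : M -> R, [/\ continuous th, th p0 = 0 & forall x, cis (th x) = lam x].
Proof.
move=> cM.
have hth x : exists (r : R) (p : {path I from p0 to x}) (P : {path I from 0 to r}), lifts p P.
  have [p _] := all_reachable cM x.
  have [|r [P hP]] := @path_lift _ _ p 0; first by rewrite lam0.
  by exists r, p, P.
have [th thP] := choice hth.
have cth x : cis (th x) = lam x.
  by have [p [P hP]] := thP x; rewrite -(path_one (s := P)) hP path_one.
exists th; split=> //; last first.
  have [p [P hP]] := thP p0.
  have [Q hQ] : exists Q : {path I from 0 to (0:R)}, lifts (cst_path p0 : {path I from p0 to p0}) Q.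
    by exists (cst_path 0) => t; rewrite /= lam0.
  exact: lift_endpoint_unique hP hQ.
move=> x.
have nb : nbhs x [set y | 1 / 2 < cdot (lam x) (lam y)] by exact: clam (cdot_near _).
have [W xW hW] := loc nb.
(* Near [x] the logarithm agrees with an explicit continuous function: a path from x to y that stays
   where the transport is valid lifts to the transported values. *)
have E : \forall y \near x, arg_transport (th x) (lam y) = th y.
  apply: filterS xW => y /hW[q hq].
  have [p [P hP]] := thP x; have [p' [P' hP']] := thP y.
  pose Qf t := arg_transport (th x) (lam (q t)).
  have cQ : continuous Qf.
    apply: arg_transport_continuous; first exact: cts_cst.
    exact: (cts_comp clam (@cts_fun _ _ q)).
  have Q0 : Qf zero = th x by rewrite /Qf path_zero -cth arg_transport_id.
  have Q1 : Qf one = arg_transport (th x) (lam y) by rewrite /Qf path_one.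
  have hQ : lifts q (mk_path cQ Q0 Q1).
    by move=> t; apply: arg_transportK; rewrite cth; exact: hq.
  exact: lift_endpoint_unique (lifts_concat hP hQ) hP'.
have c : continuous (fun y => arg_transport (th x) (lam y)).
  by apply: arg_transport_continuous => //; exact: cts_cst.
move=> A; rewrite -{1}(arg_transport_id (th x)) cth => /(c x) nA.
by apply: (@filterS2 _ (nbhs x) _ _ _ _ _ E nA) => y Ey Ay; rewrite /= -Ey.
Qed.

End Winding.

Lemma nbhs_set_type {X : topologicalType} (D : set X) (x : set_type D) (U : set (set_type D)) :
  nbhs x U -> exists2 B : set X, nbhs (\val x : X) B & forall y : set_type D, B (\val y) -> U y.
Proof.
move=> xU; rewrite nbhsE in xU; case: xU => W [[B oB BO] Ox] OU.
exists B; last by move=> y By; apply: OU; rewrite -BO.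
have Bx : B (\val x) by rewrite -[B _]/((\val @^-1` B) x) BO.
exact: (open_nbhs_nbhs (conj oB Bx)).
Qed.

Section Manifold.
Context {R : realType}.
Local Notation I := (unit_itv R).

(** The paths are straight segments in a ball of a chart, chosen so small that its preimage lies in
    [U]. *)
Lemma manifold_local_paths n (M : topologicalType) : is_manifold R n M ->
  forall (x : M) (U : set M), nbhs x U -> exists2 W, nbhs x W &
  forall y, W y -> exists q : {path I from x to y}, forall t, U (q t).
Proof.
move=> [_ _ chart] x U xU.
have [D [V [oD Dx oV [f [g [cf cg fK gK]]]]]] := chart x.
pose x' : set_type D := exist (fun u => u \in D) x (mem_set Dx).
pose v0 : 'rV[R]_n := \val (f x').
have cvalg : continuous (fun v : set_type V => \val (g v) : M).
  apply: (@cts_comp _ _ _ (fun d : set_type D => \val d)) => //; exact: initial_continuous.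
have cvalf : continuous (fun d : set_type D => \val (f d) : 'rV[R]_n).
  apply: (@cts_comp _ _ _ (fun d : set_type V => \val d)) => //; exact: initial_continuous.
have [B v0B hB] : exists2 B, nbhs v0 B & forall v : set_type V, B (\val v) -> U (\val (g v)).
  by apply: (@nbhs_set_type _ V (f x') [set v | U (\val (g v))]); apply: cvalg; rewrite fK.
have [r r0 hr] : exists2 r : R, 0 < r & forall v, `|v0 - v| < r -> V v /\ B v.
  have : nbhs v0 (V `&` B).
    by apply: filterI => //; apply: open_nbhs_nbhs; split=> //; exact: (set_valP (f x')).
  by move=> /nbhs_normP[r r0 h]; exists r.
have [B' xB' hB'] : exists2 B', nbhs x B' &
    forall d : set_type D, B' (\val d) -> `|v0 - \val (f d)| < r.
  apply: (@nbhs_set_type _ D x' [set d | `|v0 - \val (f d)| < r]).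
  by move/cvgrPdist_lt : (cvalf x'); apply.
exists (B' `&` D); first by apply: filterI => //; exact: open_nbhs_nbhs.
move=> y [B'y Dy]; pose y' : set_type D := exist (fun u => u \in D) y (mem_set Dy).
have yr : `|v0 - \val (f y')| < r by exact: hB'.
pose sg (t : I) : 'rV[R]_n := v0 + itv_val t *: (\val (f y') - v0).
have sgr t : `|v0 - sg t| < r.
  rewrite /sg opprD addNKr normrN normrZ ger0_norm ?itv_val_ge0 // distrC.
  apply: le_lt_trans yr; rewrite -[leRHS]mul1r ler_wpM2r //; exact: itv_val_le1.
pose sg' t : set_type V := exist (fun u => u \in V) (sg t) (mem_set (hr _ (sgr t)).1).
have csg : continuous sg.
  move=> t; apply: at_add; first exact: cts_cst.
  apply: (@at_scale _ _ _ _ itv_val (fun=> \val (f y') - v0)); last exact: cts_cst.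
  exact: itv_val_continuous.
have csg' : continuous sg' by exact: continuous_comp_initial.
have cq : continuous (fun t => \val (g (sg' t)) : M) := cts_comp cvalg csg'.
have q0 : \val (g (sg' zero)) = x.
  have -> : sg' zero = f x' by apply: val_inj; rewrite /= /sg itv_val0 scale0r addr0.
  by rewrite fK.
have q1 : \val (g (sg' one)) = y.
  have -> : sg' one = f y' by apply: val_inj; rewrite /= /sg itv_val1 scale1r addrC subrK.
  by rewrite fK.
exists (mk_path cq q0 q1) => t /=; apply: hB; exact: (hr _ (sgr t)).2.
Qed.

End Manifold.

(** * Spaces of based maps *)

Section BasedMapSpaces.
Context {M Y : topologicalType} {p0 : M} {y0 : Y}.

Lemma based_map_eq (f g : based_map p0 y0) : (forall x, map_of f x = map_of g x) -> f = g.
Proof. by move=> h; apply/val_inj/funext. Qed.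

(** The half of the exponential law that needs local compactness of M; with [based_curry] it
    translates between maps into the mapping space and maps on a product with M. *)
Lemma based_eval (S : topologicalType) (f : S -> based_map p0 y0) (b : S -> M) :
  hausdorff_space M -> compact [set: M] -> continuous f -> continuous b ->
  continuous (fun s => map_of (f s) (b s)).
Proof.
move=> hM cM cf cb.
have lM : locally_compact [set: M].
  move=> x _; exists setT; first by apply: (filterT : within _ _ _).
  by split=> //; exact: closedT.
have cv : continuous (fun s => \val (f s) : {compact-open, M -> Y}).
  apply: (cts_comp _ cf); exact: initial_continuous.
have cu := continuous_uncurry lM hM cv (fun s => @based_map_continuous _ _ _ _ (f s)).
have h := cts_comp cu (cts_pair (@cts_id S) cb).
exact: h.
Qed.

Lemma based_curry (T : topologicalType) (F : T -> M -> Y) :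
  continuous (fun u : T * M => F u.1 u.2) -> (forall t, F t p0 = y0) ->
  exists2 f : T -> based_map p0 y0, continuous f & forall t x, map_of (f t) x = F t x.
Proof.
move=> cF F0; have [cc cFt] := continuous_curry cF.
pose f t : based_map p0 y0 :=
  exist (fun u => u \in [set f : {compact-open, M -> Y} | continuous f /\ f p0 = y0]) (F t)
   (mem_set (conj (cFt t) (F0 t))).
by exists f => //; apply: continuous_comp_initial; exact: cc.
Qed.

End BasedMapSpaces.

Section Pullback.
Context {R : realType} {X Y : topologicalType}.

Lemma sface_comp n (f : continuousType X Y) (s : sing R X n.+1) i :
  sface i (f \o s : sing R Y n.+1) = (f \o sface i s : sing R Y n).
Proof. exact/continuousEP. Qed.

Lemma coboundary_pullback n (f : continuousType X Y) (c : cochain R Y n) s :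
  coboundary (pullback f c) s = coboundary c (f \o s : sing R Y n.+1).
Proof. by apply: eq_bigr => i _; rewrite sface_comp. Qed.

Lemma pullback_cocycle n (f : continuousType X Y) (c : cochain R Y n) :
  is_cocycle c -> is_cocycle (pullback f c).
Proof. by move=> h s; rewrite coboundary_pullback. Qed.

Lemma pullback_coboundary n (f : continuousType X Y) (c : cochain R Y n.+1) :
  is_coboundary c -> is_coboundary (pullback f c).
Proof.
move=> [b hb]; exists (pullback f b) => s.
by rewrite coboundary_pullback -hb.
Qed.

End Pullback.

(** * The circle action on the fibres and relative phases *)

Section CircleAction.
Context {R : realType}.

Fact act_subproof (w : S1 R) (z : S3 R) : let u := (S1_val w).1 in let v := (S1_val w).2 in
  (u * s3c k0 z - v * s3c k1 z) ^+ 2 + (u * s3c k1 z + v * s3c k0 z) ^+ 2 +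
  (u * s3c k2 z - v * s3c k3 z) ^+ 2 + (u * s3c k3 z + v * s3c k2 z) ^+ 2 = 1.
Proof.
have := S1P w; have := s3c_sq z; case: (S1_val w) => [u v] /= hz hw.
by rewrite -[RHS]mulr1 -{1}hw -hz; ring.
Qed.

Definition act (w : S1 R) (z : S3 R) : S3 R := S3_mk (act_subproof w z).

Lemma actE w z : (s3c k0 (act w z) = (S1_val w).1 * s3c k0 z - (S1_val w).2 * s3c k1 z) *
  (s3c k1 (act w z) = (S1_val w).1 * s3c k1 z + (S1_val w).2 * s3c k0 z) *
  (s3c k2 (act w z) = (S1_val w).1 * s3c k2 z - (S1_val w).2 * s3c k3 z) *
  (s3c k3 (act w z) = (S1_val w).1 * s3c k3 z + (S1_val w).2 * s3c k2 z).
Proof. by []. Qed.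

Lemma act_continuous (T : topologicalType) (f : T -> S1 R) (g : T -> S3 R) :
  continuous f -> continuous g -> continuous (fun t => act (f t) (g t)).
Proof.
move=> cf cg.
have cS := cts_comp S1_val_continuous cf.
have c1 : continuous (fun t => (S1_val (f t)).1) := cts_comp (@cts_fst _ _) cS.
have c2 : continuous (fun t => (S1_val (f t)).2) := cts_comp (@cts_snd _ _) cS.
have cs i : continuous (fun t => s3c i (g t)) := cts_comp (@s3c_continuous R i) cg.
apply: S3_continuous; apply: ord4_ind.
- exact: (cts_sub (cts_mul c1 (cs k0)) (cts_mul c2 (cs k1))).
- exact: (cts_add (cts_mul c1 (cs k1)) (cts_mul c2 (cs k0))).
- exact: (cts_sub (cts_mul c1 (cs k2)) (cts_mul c2 (cs k3))).
- exact: (cts_add (cts_mul c1 (cs k3)) (cts_mul c2 (cs k2))).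
Qed.

Lemma hopf_act w z : hopf (act w z) = hopf z.
Proof.
apply: S2_val_inj; rewrite !hopf_coord !actE.
have hw := S1P w; case: (S1_val w) hw => [u v] /= hw.
by congr (_, _, _); rewrite -[RHS]mul1r -hw; ring.
Qed.

Lemma act_cisD (a b : R) z : act (cis a) (act (cis b) z) = act (cis (a + b)) z.
Proof.
apply: S3_eq; apply: ord4_ind; rewrite !actE !cis_val /= cosD sinD; ring.
Qed.

Lemma act_cis0 z : act (cis 0) z = z.
Proof.
by apply: S3_eq; apply: ord4_ind; rewrite !actE !cis_val /= cos0 sin0; ring.
Qed.

(** Real and imaginary parts of the Hermitian product conj(z1) z1' + conj(z2) z2'. For points of one
    fibre it is the phase from [z] to [z']; being polynomial, it makes the phase chosen pointwise in
    [phase] continuous. *)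
Definition quot (z z' : S3 R) : R * R :=
  (s3c k0 z * s3c k0 z' + s3c k1 z * s3c k1 z' + s3c k2 z * s3c k2 z' + s3c k3 z * s3c k3 z',
   s3c k0 z * s3c k1 z' - s3c k1 z * s3c k0 z' + s3c k2 z * s3c k3 z' - s3c k3 z * s3c k2 z').

Lemma quot_act w z : quot z (act w z) = S1_val w.
Proof.
rewrite /quot !actE; have hz := s3c_sq z; case: (S1_val w) => [u v] /=.
by congr (_, _); rewrite -[RHS]mulr1 -hz; ring.
Qed.

Lemma hopf_eq_act (z z' : S3 R) : hopf z = hopf z' -> exists w, act w z = z'.
Proof.
move=> /hopf_fiber[[x y] [l1 E]].
have xy : x ^+ 2 + y ^+ 2 = 1.
  have : `|(x +i* y)%C| ^+ 2 = 1 by rewrite l1 expr1n.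
  by rewrite -add_Re2_Im2 /= => -[].
exists (S1_mk xy); apply: S3_eq.
have V : S1_val (S1_mk xy) = (x, y) by [].
move: E; case E0 : (S3_val z) => [[a b] [c d]] /=; case E1 : (S3_val z') => [[a' b'] [c' d']].
move=> -[e0 e1 e2 e3]; apply: ord4_ind; rewrite actE V /s3c /= E0 E1 /= ?e0 ?e1 ?e2 ?e3; ring.
Qed.

Lemma phase (T : topologicalType) (f g : T -> S3 R) : continuous f -> continuous g ->
  (forall t, hopf (f t) = hopf (g t)) ->
  exists2 w : T -> S1 R, continuous w & forall t, act (w t) (f t) = g t.
Proof.
move=> cf cg fg.
have [w hw] := choice (fun t => hopf_eq_act (fg t)).
have wE t : S1_val (w t) = quot (f t) (g t) by rewrite -hw quot_act.
exists w => //.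
have cs i : continuous (fun t => s3c i (f t)) := cts_comp (@s3c_continuous R i) cf.
have cs' i : continuous (fun t => s3c i (g t)) := cts_comp (@s3c_continuous R i) cg.
apply: S1_continuous.
  rewrite (_ : (fun _ => _) = fun t => (quot (f t) (g t)).1); last first.
    by apply/funext => t; rewrite wE.
  rewrite /quot /=.
  by apply: cts_add; first (apply: cts_add; first apply: cts_add); exact: cts_mul.
rewrite (_ : (fun _ => _) = fun t => (quot (f t) (g t)).2); last first.
  by apply/funext => t; rewrite wE.
rewrite /quot /=.
by apply: cts_sub; first (apply: cts_add; first apply: cts_sub); exact: cts_mul.
Qed.

Lemma phase_self (w : S1 R) z : act w z = z -> w = cis 0.
Proof.
move=> h; apply: S1_val_inj; rewrite -(quot_act w z) h -{2}(act_cis0 z) quot_act.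
by [].
Qed.

End CircleAction.

(** * Lifting loops and homotopies in the mapping spaces *)

Section HopfOnMaps.
Context {R : realType} {M : topologicalType} (p0 : M) (mu : cochain R (S2 R) 2).
Context (hM : hausdorff_space M) (cM : compact [set: M]) (conM : connected [set: M]).
Local Notation I := (unit_itv R).

Lemma inessential_eq (f g : inessential_maps p0 mu) :
  (forall x, map_of (inessential_val f) x = map_of (inessential_val g) x) -> f = g.
Proof. by move=> h; apply/val_inj/based_map_eq. Qed.

Lemma inessential_eval (S : topologicalType) (f : S -> inessential_maps p0 mu) (b : S -> M) :
  continuous f -> continuous b ->
  continuous (fun s => map_of (inessential_val (f s)) (b s)).
Proof.
move=> cf cb; apply: (@based_eval _ _ _ _ S (fun s => inessential_val (f s))) => //.
apply: (cts_comp _ cf); exact: initial_continuous.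
Qed.

Lemma hopf_maps : is_cocycle mu ->
  exists rho : continuousType (S3_maps R p0) (inessential_maps p0 mu),
  forall psi x, map_of (inessential_val (rho psi)) x = hopf (map_of psi x).
Proof.
move=> cmu.
have cF : continuous (fun u : S3_maps R p0 * M => hopf (map_of u.1 u.2)).
  apply: (cts_comp (@hopf_continuous R)).
  by apply: based_eval => //; [exact: cts_fst|exact: cts_snd].
have [|r cr rE] := @based_curry M (S2 R) p0 (@S2_pt R) (S3_maps R p0)
    (fun psi x => hopf (map_of psi x)) cF.
  by move=> psi; rewrite map_of_pt hopf_pt.
pose hp : continuousType (S3 R) (S2 R) := mkcts (@hopf_continuous R).
(* One primitive on S^3 serves all maps at once: pulled back along psi, it bounds the pullback of
   [mu] along the composite. *)
have hc : is_coboundary (pullback hp mu).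
  by apply: S3_cocycle_coboundary; exact: pullback_cocycle.
have ie psi : inessential mu (r psi).
  have [b hb] := pullback_coboundary (map_of psi) hc.
  exists b => s; rewrite -hb; congr mu; apply/continuousEP => t /=.
  exact: rE.
pose rho psi : inessential_maps p0 mu :=
  exist (fun u => u \in inessential mu) (r psi) (mem_set (ie psi)).
have crho : continuous rho by apply: continuous_comp_initial; exact: cr.
by exists (mkcts crho) => psi x; exact: rE.
Qed.

Context (rho : continuousType (S3_maps R p0) (inessential_maps p0 mu)).
Context (rhoE : forall psi x, map_of (inessential_val (rho psi)) x = hopf (map_of psi x)).
Context (psi0 : S3_maps R p0).

(** Rotation within the fibres is invisible after projection, so the corrected loop maps to [q] on
    the nose and not only up to homotopy. *)
Lemma hopf_loop_lift
    (circle_log : forall lam : M -> S1 R, continuous lam -> lam p0 = cis 0 ->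
      exists th : M -> R, [/\ continuous th, th p0 = 0 & forall x, cis (th x) = lam x])
    (q : loop R (rho psi0)) :
  exists p : loop R psi0, forall t, rho (p t) = q t.
Proof.
pose Phi (u : M * I) := map_of (inessential_val (q u.2)) u.1.
have cPhi : continuous Phi.
  apply: inessential_eval; last exact: cts_fst.
  exact: (cts_comp (@cts_fun _ _ q) (@cts_snd _ _)).
have Phi0 x : Phi (x, zero) = hopf (map_of psi0 x) by rewrite /Phi /= path_zero rhoE.
have Phi1 x : Phi (x, one) = hopf (map_of psi0 x) by rewrite /Phi /= path_one rhoE.
have [|Z [cZ hZ Z0 Zs]] := hopf_lift cM cPhi (@cts_fun _ _ (map_of psi0)).
  by move=> x; rewrite Phi0.
(* All maps are based, so [Phi] is stationary at [p0] and the lift stays at the base point. *)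
have Zp0 t : Z (p0, t) = @S3_pt R.
  by rewrite Zs ?map_of_pt // => s; rewrite /Phi /= !map_of_pt.
have cZ1 : continuous (fun x => Z (x, one)).
  by apply: (cts_comp cZ); apply: cts_pair; [exact: cts_id|exact: cts_cst].
have [|lam clam lamE] := phase (@cts_fun _ _ (map_of psi0)) cZ1.
  by move=> x; rewrite hZ Phi1.
have [||th [cth th0 thE]] := circle_log lam => //.
  by apply: (@phase_self _ _ (@S3_pt R)); have := lamE p0; rewrite Zp0 map_of_pt.
(* The lift ends at act (cis (th x)) (psi0 x); this rotation closes it up. *)
pose F (t : I) (x : M) := act (cis (- (itv_val t * th x))) (Z (x, t)).
have cF : continuous (fun u : I * M => F u.1 u.2).
  apply: act_continuous.
    apply: (cts_comp (@cis_continuous R)) => u; apply: cvgN; move: u.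
    apply: cts_mul; first exact: (cts_comp itv_val_continuous (@cts_fst _ _)).
    exact: (cts_comp cth (@cts_snd _ _)).
  by apply: (cts_comp cZ); apply: cts_pair; [exact: cts_snd|exact: cts_fst].
have Fp0 t : F t p0 = @S3_pt R by rewrite /F th0 mulr0 oppr0 act_cis0 Zp0.
have [f cf fE] := based_curry cF Fp0.
have f0 : f zero = psi0.
  apply: based_map_eq => x; rewrite fE /F itv_val0 mul0r oppr0 act_cis0.
  exact: Z0.
have f1 : f one = psi0.
  apply: based_map_eq => x; rewrite fE /F itv_val1 mul1r -lamE -thE act_cisD.
  by rewrite addNr act_cis0.
exists (mk_path cf f0 f1) => t; apply: inessential_eq => x.
by rewrite rhoE /= fE /F hopf_act hZ.
Qed.

Lemma hopf_homotopy_lift (p q : loop R psi0) :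
  @path_homotopic R _ (rho psi0) (rho psi0) (rho \o p) (rho \o q) -> path_homotopic p q.
Proof.
move=> [H [cH H0 H1 Hs]].
pose Phi (u : (I * M) * I) := map_of (inessential_val (H (u.1.1, u.2))) u.1.2.
have c11 : continuous (fun u : (I * M) * I => u.1.1).
  exact: (cts_comp (@cts_fst _ _) (@cts_fst _ _)).
have c12 : continuous (fun u : (I * M) * I => u.1.2).
  exact: (cts_comp (@cts_snd _ _) (@cts_fst _ _)).
have cPhi : continuous Phi.
  apply: inessential_eval => //.
  by apply: (cts_comp cH); apply: cts_pair => //; exact: cts_snd.
pose ev (g : loop R psi0) (u : I * M) := map_of (g u.1) u.2.
have cev g : continuous (ev g).
  apply: based_eval => //; last exact: cts_snd.
  exact: (cts_comp (@cts_fun _ _ g) (@cts_fst _ _)).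
have cIM : compact [set: I * M].
  by rewrite -setXTT; exact: compact_setX (@unit_itv_compact R) cM.
have [|Z [cZ hZ Z0 Zs]] := hopf_lift cIM cPhi (cev p).
  by move=> [t x]; rewrite /Phi /= H0 /= rhoE.
have Zp0 t s : Z ((t, p0), s) = @S3_pt R.
  by rewrite Zs ?/ev ?map_of_pt // => s'; rewrite /Phi /= !map_of_pt.
have Zzero x s : Z ((zero, x), s) = map_of psi0 x.
  rewrite Zs; first by rewrite /ev /= path_zero.
  by move=> s'; rewrite /Phi /= (Hs s').1 (Hs zero).1.
have Zone x s : Z ((one, x), s) = map_of psi0 x.
  rewrite Zs; first by rewrite /ev /= path_one.
  by move=> s'; rewrite /Phi /= (Hs s').2 (Hs zero).2.
have cZ' : continuous (fun u : (I * I) * M => Z ((u.1.1, u.2), u.1.2)).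
  apply: (cts_comp cZ); apply: cts_pair; first apply: cts_pair.
  - exact: (cts_comp (@cts_fst _ _) (@cts_fst _ _)).
  - exact: cts_snd.
  - exact: (cts_comp (@cts_snd _ _) (@cts_fst _ _)).
have [K cK KE] := @based_curry M (S3 R) p0 (@S3_pt R) (I * I)%type
  (fun u x => Z ((u.1, x), u.2)) cZ' (fun u => Zp0 u.1 u.2).
have ceta : continuous (fun t => K (t, one)).
  by apply: (cts_comp cK); apply: cts_pair; [exact: cts_id|exact: cts_cst].
have eta0 : K (zero, one) = psi0 by apply: based_map_eq => x; rewrite KE /= Zzero.
have eta1 : K (one, one) = psi0 by apply: based_map_eq => x; rewrite KE /= Zone.
pose eta : loop R psi0 := mk_path ceta eta0 eta1.
(* The lifted homotopy joins [p] to [eta]; [eta] and [q] then have the same projection and differ by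
   a phase. *)
apply: (@path_homotopic_trans _ _ _ _ _ eta).
  exists K; split=> // [t|s].
    by apply: based_map_eq => x; rewrite KE /= Z0.
  by split; apply: based_map_eq => x; rewrite KE /= ?Zzero ?Zone.
have cZ1 : continuous (fun u : M * I => Z ((u.2, u.1), one)).
  apply: (cts_comp cZ); apply: cts_pair; last exact: cts_cst.
  by apply: cts_pair; [exact: cts_snd|exact: cts_fst].
have cq : continuous (fun u : M * I => ev q (u.2, u.1)).
  by apply: (cts_comp (cev q)); apply: cts_pair; [exact: cts_snd|exact: cts_fst].
have [|lam clam lamE] := phase cq cZ1.
  by move=> [x t]; rewrite hZ /Phi /= H1 /= rhoE.
have lam0 x : lam (x, zero) = cis 0.
  apply: (@phase_self _ _ (map_of psi0 x)).
  by have := lamE (x, zero); rewrite /= Zzero /ev /= path_zero.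
have lam1 x : lam (x, one) = cis 0.
  apply: (@phase_self _ _ (map_of psi0 x)).
  by have := lamE (x, one); rewrite /= Zone /ev /= path_one.
have lamp0 t : lam (p0, t) = cis 0.
  apply: (@phase_self _ _ (@S3_pt R)).
  by have := lamE (p0, t); rewrite /= Zp0 /ev /= map_of_pt.
(* At loop parameter [zero] both loops are at [psi0], so the phase is 1 there and its logarithm can
   start from 0 over all of M. *)
have [x|th [cth thE th0 ths]] := circle_lift cM clam (@cts_cst M R 0).
  by rewrite lam0.
have thp0 t : th (p0, t) = 0 by rewrite ths // => s; rewrite !lamp0.
(* At parameter [one] the phase is again 1, so [th] is constant over the connected M; its value at
   [p0] is 0. *)
have th1 x : th (x, one) = 0.
  rewrite -(thp0 one); apply: (@connected_cis_const _ _ (fun x => th (x, one))) => //.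
    by apply: (cts_comp cth); apply: cts_pair; [exact: cts_id|exact: cts_cst].
  by move=> y z; rewrite !thE !lam1.
(* Scaling the logarithm down to 0 contracts [eta] to [q]; the base point and both ends of the loop
   stay fixed because [th] vanishes there. *)
pose G (u : I * I) (x : M) :=
  act (cis ((1 - itv_val u.2) * th (x, u.1))) (ev q (u.1, x)).
have cG : continuous (fun u : (I * I) * M => G u.1 u.2).
  have d1 : continuous (fun u : (I * I) * M => u.1.1).
    exact: (cts_comp (@cts_fst _ _) (@cts_fst _ _)).
  have d2 : continuous (fun u : (I * I) * M => u.1.2).
    exact: (cts_comp (@cts_snd _ _) (@cts_fst _ _)).
  apply: act_continuous.
    apply: (cts_comp (@cis_continuous R)); apply: cts_mul.
      by apply: cts_sub; [exact: cts_cst|exact: (cts_comp itv_val_continuous d2)].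
    by apply: (cts_comp cth); apply: cts_pair => //; exact: cts_snd.
  by apply: (cts_comp (cev q)); apply: cts_pair => //; exact: cts_snd.
have Gp0 u : G u p0 = @S3_pt R by rewrite /G thp0 mulr0 act_cis0 /ev map_of_pt.
have [L cL LE] := based_curry cG Gp0.
exists L; split=> // [t|t|s].
- apply: based_map_eq => x; rewrite LE /G /= itv_val0 subr0 mul1r thE KE /=.
  exact: (lamE (x, t)).
- apply: based_map_eq => x; rewrite LE /G /= itv_val1 subrr mul0r act_cis0.
  by [].
- split; apply: based_map_eq => x; rewrite LE /G /= ?th0 ?th1 mulr0 act_cis0 /ev /=.
    by rewrite path_zero.
  by rewrite path_one.
Qed.

End HopfOnMaps.

Theorem corollary3 (R : realType) (M : topologicalType) (p0 : M)
    (o : M -> chain R M 3) (mu : cochain R (S2 R) 2) :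
  is_manifold R 3 M ->
  compact [set: M] ->
  connected [set: M] ->
  is_orientation o ->
  generating_cocycle mu ->
  finite_set [set: pi1 R p0] ->
  exists rho : continuousType (S3_maps R p0) (inessential_maps p0 mu),
    (forall (psi : S3_maps R p0) (x : M),
        map_of (inessential_val (rho psi)) x = hopf (map_of psi x)) /\
    forall psi0 : S3_maps R p0,
      {morph @pi1_map R _ _ rho psi0 : a b / (a * b)%g >-> (a * b)%g} /\
      bijective (@pi1_map R _ _ rho psi0).
Proof.
move=> mM cM conM _ [cmu _] fin.
have [hM _ _] := mM.
have [rho rhoE] := hopf_maps p0 hM cM cmu.
exists rho; split=> // psi0; split; first exact: pi1_mapM.
have log (lam : M -> S1 R) (clam : continuous lam) (lam0 : lam p0 = cis 0) :=
  circle_log clam lam0 fin (manifold_local_paths mM) conM.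
have surj b : exists a, pi1_map rho a = b :> pi1 R (rho psi0).
  have [p hp] := hopf_loop_lift hM cM rhoE log (repr b).
  exists (loop_class p); rewrite pi1_mapE -[RHS]loop_class_repr.
  by congr loop_class; apply/path_eqP => t; exact: hp.
have [g gK] := choice surj.
have inj : injective (@pi1_map R _ _ rho psi0).
  move=> a b; rewrite -(loop_class_repr a) -(loop_class_repr b) !pi1_mapE.
  by move=> /loop_classP/(hopf_homotopy_lift hM cM conM rhoE) h; apply/loop_classP.
by exists g => // a; apply: inj; rewrite gK.
Qed.
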